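(* \textsc{ReachFast} with any number of sources can be solved in polynomial time on temporal graphs whose underlying graph is a tree. That is, given such a temporal graph $\mathcal{G}$ and a set of sources $S$, one can compute in polynomial time a solution of minimum value.
   Context: A temporal graph $\mathcal{G}=\langle G,(E_1,\dots,E_{t_{\max}})\rangle$ consists of a static graph $G=(V,E)$ and edge sets $E_i\subseteq E$ with $E=\bigcup_i E_i$. An edge has label $i$ if it lies in $E_i$. A temporal path uses edges with strictly increasing labels, and its arrival time is its last label. $\mathrm{reachtime}(v,\mathcal{G})$ is the least $t$ such that $v$ reaches every vertex by a temporal path with arrival time at most $t$, and $\infty$ if some vertex is unreachable. Delaying a label $i$ by a positive integer $\delta$ replaces it by $i+\delta$, and the new label may exceed $t_{\max}$. A solution for sources $S$ is a temporal graph $\mathcal{G}'$ obtained by delaying any number of labels such that every source reaches every vertex. Its value is $\max_{v\in S}\mathrm{reachtime}(v,\mathcal{G}')$. *)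

(* Defs.v *)
From mathcomp Require Import all_boot.
From Stdlib Require Import ClassicalEpsilon.
Set Implicit Arguments. Unset Strict Implicit. Unset Printing Implicit Defensive.

(* Vertices are 0, ..., n-1.  A temporal graph is given by a list of    *)
(* time-edges (u, w, t): the (undirected) edge {u,w} carries label t,   *)
(* i.e. {u,w} \in E_t.  Labels are positive integers.                   *)
Definition tedge := (nat * nat * nat)%type.

Definition has_tedge (E : seq tedge) (u w t : nat) : bool :=
  ((u, w, t) \in E) || ((w, u, t) \in E).

Definition sedge (E : seq tedge) (u w : nat) : bool :=
  has (fun x : tedge => let: (a, b, _) := x in
        ((a == u) && (b == w)) || ((a == w) && (b == u))) E.

Definition wf_tgraph (n : nat) (E : seq tedge) : bool :=
  all (fun x : tedge => let: (a, b, t) := x in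
        [&& a < n, b < n, a != b & 0 < t]) E.

Definition connected_on (n : nat) (E : seq tedge) : Prop :=
  forall u w, u < n -> w < n ->
    exists p : seq nat, path (sedge E) u p && (last u p == w).

Definition acyclic_on (n : nat) (E : seq tedge) : Prop :=
  forall c : seq nat, all (fun x => x < n) c -> uniq c -> 3 <= size c ->
    ~~ cycle (sedge E) c.

Definition is_tree (n : nat) (E : seq tedge) : Prop :=
  0 < n /\ connected_on n E /\ acyclic_on n E.

(* tpath E v w a : there is a temporal path from v to w (strictly
   increasing labels) with arrival time a; the empty path from v to v
   has arrival time 0 (labels are >= 1). *)
Inductive tpath (E : seq tedge) (v : nat) : nat -> nat -> Prop :=
| tp_nil : tpath E v v 0
| tp_cons u w a l : tpath E v u a -> has_tedge E u w l -> a < l ->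
                    tpath E v w l.

Definition reaches_all_by (n : nat) (E : seq tedge) (v t : nat) : Prop :=
  forall w, w < n -> exists a, a <= t /\ tpath E v w a.

Definition decP (P : Prop) : bool :=
  if excluded_middle_informative P then true else false.

Lemma decPP (P : Prop) : reflect P (decP P).
Proof. by rewrite /decP; case: excluded_middle_informative => H; constructor. Qed.

Lemma reachtime_ex (n : nat) (E : seq tedge) (v : nat) :
  (exists t, reaches_all_by n E v t) ->
  exists t, decP (reaches_all_by n E v t).
Proof. by case=> t Ht; exists t; apply/decPP. Qed.

(* reachtime(v, G) : None encodes infinity *)
Definition reachtime (n : nat) (E : seq tedge) (v : nat) : option nat :=
  match excluded_middle_informative (exists t, reaches_all_by n E v t) with
  | left H => Some (ex_minn (reachtime_ex H))
  | right _ => None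
  end.

Definition maxo (a b : option nat) : option nat :=
  match a, b with Some x, Some y => Some (maxn x y) | _, _ => None end.

Definition leo (a b : option nat) : bool :=
  match a, b with
  | _, None => true
  | None, Some _ => false
  | Some x, Some y => x <= y
  end.

Definition value (n : nat) (S : seq nat) (E : seq tedge) : option nat :=
  foldr maxo (Some 0) [seq reachtime n E s | s <- S].

Definition is_delay (E E' : seq tedge) : Prop :=
  exists d : nat -> nat -> nat -> nat,
    (forall u w t, d u w t = d w u t) /\
    (forall u w t', has_tedge E' u w t' <->
        exists t, has_tedge E u w t /\ t' = t + d u w t).

Definition is_solution (n : nat) (S : seq nat) (E E' : seq tedge) : Prop :=
  is_delay E E' /\
  (forall s, s \in S -> forall w, w < n -> exists a, tpath E' s w a).

Definition is_opt_solution (n : nat) (S : seq nat) (E E' : seq tedge) : Prop :=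
  is_solution n S E E' /\
  forall E'', is_solution n S E E'' -> leo (value n S E') (value n S E'').

(* Machine model: unit-cost RAM with addition, truncated subtraction,   *)
(* indirect addressing and conditional jumps (polynomially equivalent   *)
(* to Turing machines w.r.t. the bit-size of the input).                *)
Inductive instr :=
| IConst (r c : nat)
| IAdd (r a b : nat)
| ISub (r a b : nat)
| ILoad (r a : nat)
| IStore (a r : nat)
| IJz (r l : nat)
| IHalt.

Definition program := seq instr.
Definition state := (nat * (nat -> nat))%type.

Definition upd (m : nat -> nat) (r x : nat) : nat -> nat :=
  fun i => if i == r then x else m i.

Definition step (p : program) (s : state) : option state :=
  let: (pc, m) := s in
  match nth IHalt p pc with
  | IConst r c => Some (pc.+1, upd m r c)
  | IAdd r a b => Some (pc.+1, upd m r (m a + m b))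
  | ISub r a b => Some (pc.+1, upd m r (m a - m b))
  | ILoad r a => Some (pc.+1, upd m r (m (m a)))
  | IStore a r => Some (pc.+1, upd m (m a) (m r))
  | IJz r l => Some (if m r == 0 then l else pc.+1, m)
  | IHalt => None
  end.

Definition halted (p : program) (s : state) : bool :=
  if step p s is None then true else false.

Fixpoint exec (p : program) (k : nat) (s : state) : state :=
  match k with
  | 0 => s
  | k'.+1 => match step p s with None => s | Some s' => exec p k' s' end
  end.

Definition init (inp : seq nat) : state :=
  (0, fun i => if i == 0 then size inp else nth 0 inp i.-1).

Definition output (s : state) : seq nat := mkseq (fun i => s.2 i.+1) (s.2 0).

Definition bitlen (x : nat) : nat := (trunc_log 2 x).+1.
Definition insize (inp : seq nat) : nat := size inp + sumn (map bitlen inp).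

Definition enc_edges (E : seq tedge) : seq nat :=
  flatten [seq let: (u, w, t) := x in [:: u; w; t] | x : tedge <- E].

Definition enc_instance (n : nat) (E : seq tedge) (S : seq nat) : seq nat :=
  [:: n, size E & enc_edges E] ++ size S :: S.

Definition valid_tree_instance (n : nat) (E : seq tedge) (S : seq nat) : Prop :=
  wf_tgraph n E /\ is_tree n E /\ all (fun s => s < n) S.

Definition correct_answer (n : nat) (E : seq tedge) (S : seq nat)
  (out : seq nat) : Prop :=
  ((exists E', is_solution n S E E') ->
     exists E', out = 1 :: enc_edges E' /\ is_opt_solution n S E E') /\
  ((~ exists E', is_solution n S E E') -> out = [:: 0]).

(* Main.v *)
(* For a directed edge u -> v of the tree, let x(u -> v) be the time at which the
   last source on the side of u reaches v.  In every solution x(u -> v) is a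
   label of uv after the delays, and x(w -> u) < x(u -> v) for w <> v.  If two
   edges were crossed in both directions with x(u -> v) = x(v -> u), the two
   strict inequalities along the path joining them would contradict each other;
   hence there is a center, a vertex or an edge {a, b}, such that x is smaller
   towards the center than away from it on every other edge used in both
   directions.  Such an edge needs two distinct labels, so its away direction is
   bounded below by its second smallest label; all other directions are bounded
   by the smallest label.  For a fixed center the least x that satisfies these
   bounds and x(w -> u) + 1 <= x(u -> v) is realized by delaying labels, so it
   suffices to try all centers.

   The search is written in a language of bounded loops over arrays, whose
   running time is polynomial by construction, and compiled to the machine. *)

(* A label of an edge receives one delay, shared by both directions. Two directions that cross an
   edge at different times therefore start from different original labels, and the later crossing is
   not before the second smallest label. This is the obstacle: which direction is the later one
   depends on the solution. A center decides it for every edge but its own; the direction towards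
   the center then takes the smallest label, and the direction away from it takes over all the other
   labels. On a center edge both directions may share a label and must then agree on the time. A
   simple path that enters an edge has not crossed that edge before, so raising both bounds to the
   later time does not feed back, and one repetition of the computation is enough. A pair that is
   not the center of any solution does no harm: each candidate is tested for consistency, and
   passing the test already yields a solution. Loops are bounded by sixteen times the input length
   and arrays are indexed by time-edges or vertices, so the magnitude of the labels does not enter
   the number of steps. *)
Require Import Defs.
From mathcomp Require Import all_boot zify.
From Stdlib Require Import ClassicalEpsilon.
Set Implicit Arguments. Unset Strict Implicit. Unset Printing Implicit Defensive.

(** * A loop language and its compilation *)

(** Branching is confined to expressions, and loops have no early exit, so that a bound on the
    running time depends on the loop bound alone. *)
Inductive expr :=
| EC of nat
| EV of nat
| ER of nat & expr
| EAdd of expr & expr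
| ESub of expr & expr
| EIf of expr & expr & expr
| EMax of nat & expr.

Inductive cmd :=
| CSet of nat & expr & expr
| CSeq of cmd & cmd
| CFor of nat & cmd
| CIn of nat
| COut of nat.

Definition store := nat -> nat -> nat.

Definition upd2 (st : store) (a i x : nat) : store :=
  fun b j => if (b == a) && (j == i) then x else st b j.

Fixpoint eval (N : nat) (env : nat -> nat) (st : store) (e : expr) : nat :=
  match e with
  | EC c => c
  | EV x => env x
  | ER a e => st a (eval N env st e)
  | EAdd e1 e2 => eval N env st e1 + eval N env st e2
  | ESub e1 e2 => eval N env st e1 - eval N env st e2
  | EIf e1 e2 e3 =>
      if eval N env st e1 == 0 then eval N env st e3 else eval N env st e2
  | EMax x e => \max_(i < N) eval N (upd env x i) st e
  end.

(** Cells up to 39 are registers, saved and restored by the code around the command. Input entry [i]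
    sits in machine cell [i.+1], whence the shift in [CIn]; the output already contains its length
    in cell 0 and is copied without a shift. *)
Fixpoint sem (N : nat) (env : nat -> nat) (c : cmd) (st : store) : store :=
  match c with
  | CSet a e1 e2 => upd2 st a (eval N env st e1) (eval N env st e2)
  | CSeq c1 c2 => sem N env c2 (sem N env c1 st)
  | CFor x c => iteri N (fun i => sem N (upd env x i) c) st
  | CIn x => if 39 < env x then upd2 st 0 (env x - 1) (st 16 (env x)) else st
  | COut x => if 39 < env x then upd2 st 16 (env x) (st 0 (env x)) else st
  end.

(** Four doublings replace the multiplication by 16, the distance between consecutive cells of one
    array. *)
Definition addr (l a : nat) : seq instr :=
  [:: IAdd (12 + l) (12 + l) (12 + l); IAdd (12 + l) (12 + l) (12 + l);
      IAdd (12 + l) (12 + l) (12 + l); IAdd (12 + l) (12 + l) (12 + l);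
      IConst 3 a; IAdd (12 + l) (12 + l) 3; IAdd (12 + l) (12 + l) 2].

(** Jump targets are absolute, hence the parameter [pc]; [l] is the height of an evaluation stack
    kept in the registers from 12 on. [IJz 0 _] jumps unconditionally because register 0 holds 0,
    and a maximum is accumulated as [t + (v - t)] with truncated subtraction. *)
Fixpoint comp (pc l : nat) (e : expr) : seq instr :=
  match e with
  | EC c => [:: IConst (12 + l) c]
  | EV x => [:: IAdd (12 + l) (4 + x) 0]
  | ER a e => comp pc l e ++ addr l a ++ [:: ILoad (12 + l) (12 + l)]
  | EAdd e1 e2 =>
      let c1 := comp pc l e1 in
      c1 ++ comp (pc + size c1) l.+1 e2 ++ [:: IAdd (12 + l) (12 + l) (12 + l.+1)]
  | ESub e1 e2 =>
      let c1 := comp pc l e1 in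
      c1 ++ comp (pc + size c1) l.+1 e2 ++ [:: ISub (12 + l) (12 + l) (12 + l.+1)]
  | EIf e1 e2 e3 =>
      let c1 := comp pc l e1 in
      let c2 := comp (pc + size c1 + 1) l e2 in
      let q := pc + size c1 + 1 + size c2 + 1 in
      let c3 := comp q l e3 in
      c1 ++ [:: IJz (12 + l) q] ++ c2 ++ [:: IJz 0 (q + size c3)] ++ c3
  | EMax x e =>
      let c := comp (pc + 4) l.+1 e in
      [:: IConst (12 + l) 0; IConst (4 + x) 0; ISub 3 2 (4 + x);
          IJz 3 (pc + 4 + size c + 4)] ++ c ++
      [:: ISub (12 + l.+1) (12 + l.+1) (12 + l);
          IAdd (12 + l) (12 + l) (12 + l.+1);
          IAdd (4 + x) (4 + x) 1; IJz 0 (pc + 2)]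
  end.

Fixpoint compc (pc : nat) (c : cmd) : seq instr :=
  match c with
  | CSet a e1 e2 =>
      let c1 := comp pc 0 e1 in
      c1 ++ comp (pc + size c1) 1 e2 ++ addr 0 a ++ [:: IStore (12 + 0) (12 + 1)]
  | CSeq c1 c2 => compc pc c1 ++ compc (pc + size (compc pc c1)) c2
  | CFor x c =>
      let b := compc (pc + 3) c in
      [:: IConst (4 + x) 0; ISub 3 2 (4 + x); IJz 3 (pc + 3 + size b + 2)] ++ b ++
      [:: IAdd (4 + x) (4 + x) 1; IJz 0 (pc + 1)]
  | CIn x =>
      [:: IConst 3 39; ISub (12 + 0) (4 + x) 3; IJz (12 + 0) (pc + 13)] ++
      [:: ISub (12 + 0) (4 + x) 1; ILoad (12 + 1) (4 + x)] ++
      addr 0 0 ++ [:: IStore (12 + 0) (12 + 1)]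
  | COut x =>
      [:: IConst 3 39; ISub (12 + 0) (4 + x) 3; IJz (12 + 0) (pc + 13)] ++
      [:: IAdd (12 + 0) (4 + x) 0] ++
      addr 0 0 ++ [:: ILoad (12 + 1) (12 + 0); IStore (4 + x) (12 + 1)]
  end.

(** Loop variables are named by nesting depth, so active loops own distinct counters in registers 4
    to 11. Registers 12 to 39 form the evaluation stack, and register 3 is scratch. *)
Fixpoint wf (d l : nat) (e : expr) : bool :=
  (l < 28) &&
  match e with
  | EC _ => true
  | EV x => x < d
  | ER a e => (a < 16) && wf d l e
  | EAdd e1 e2 | ESub e1 e2 => wf d l e1 && wf d l.+1 e2
  | EIf e1 e2 e3 => [&& wf d l e1, wf d l e2 & wf d l e3]
  | EMax x e => [&& x == d, d < 8 & wf d.+1 l.+1 e]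
  end.

Fixpoint wfc (d : nat) (c : cmd) : bool :=
  match c with
  | CSet a e1 e2 => [&& a < 16, wf d 0 e1 & wf d 1 e2]
  | CSeq c1 c2 => wfc d c1 && wfc d c2
  | CFor x c => [&& x == d, d < 8 & wfc d.+1 c]
  | CIn x | COut x => (x < d) && (d <= 8)
  end.

Fixpoint cost (N : nat) (e : expr) : nat :=
  match e with
  | EC _ | EV _ => 1
  | ER _ e => cost N e + 8
  | EAdd e1 e2 | ESub e1 e2 => cost N e1 + cost N e2 + 1
  | EIf e1 e2 e3 => cost N e1 + cost N e2 + cost N e3 + 2
  | EMax _ e => 4 + N * (cost N e + 6)
  end.

Fixpoint costc (N : nat) (c : cmd) : nat :=
  match c with
  | CSet _ e1 e2 => cost N e1 + cost N e2 + 8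
  | CSeq c1 c2 => costc N c1 + costc N c2
  | CFor _ c => 3 + N * (costc N c + 4)
  | CIn _ | COut _ => 13
  end.

(** * Execution of code blocks and correctness of the compilation *)

Lemma exec_add p k1 k2 s : exec p (k1 + k2) s = exec p k2 (exec p k1 s).
Proof.
elim: k1 s => //= k1 IH s; case Hs: (step p s) => [s'|]; first exact: IH.
by case: k2 {IH} => //= k2; rewrite Hs.
Qed.

Definition runs (p : program) (b : nat) (s s' : state) : Prop :=
  exists2 k, k <= b & exec p k s = s'.

Lemma runs_trans p b1 b2 s1 s2 s3 :
  runs p b1 s1 s2 -> runs p b2 s2 s3 -> runs p (b1 + b2) s1 s3.
Proof.
move=> [k1 h1 e1] [k2 h2 e2]; exists (k1 + k2); first exact: leq_add.
by rewrite exec_add e1.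
Qed.

Lemma runs_le p b b' s s' : b <= b' -> runs p b s s' -> runs p b' s s'.
Proof. by move=> h [k hk e]; exists k => //; exact: leq_trans h. Qed.

Lemma runs_to p b b' s q q' m : runs p b s (q, m) -> b <= b' -> q = q' ->
  runs p b' s (q', m).
Proof. by move=> h hb <-; exact: runs_le h. Qed.

Definition code_at (p : program) (pc : nat) (c : seq instr) : Prop :=
  forall i, i < size c -> nth IHalt p (pc + i) = nth IHalt c i.

Lemma code_at_cat p pc c1 c2 :
  code_at p pc (c1 ++ c2) -> code_at p pc c1 /\ code_at p (pc + size c1) c2.
Proof.
move=> h; split=> i hi.
  by rewrite h ?nth_cat ?hi // size_cat ltn_addr.
rewrite -addnA h ?size_cat ?ltn_add2l // nth_cat ltnNge leq_addr /=.
by rewrite addKn.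
Qed.

Definition instr_sem (i : instr) (m : nat -> nat) : nat -> nat :=
  match i with
  | IConst r c => upd m r c
  | IAdd r a b => upd m r (m a + m b)
  | ISub r a b => upd m r (m a - m b)
  | ILoad r a => upd m r (m (m a))
  | IStore a r => upd m (m a) (m r)
  | _ => m
  end.

Definition plain (i : instr) : bool :=
  match i with IJz _ _ | IHalt => false | _ => true end.

Definition block_sem (c : seq instr) (m : nat -> nat) : nat -> nat :=
  foldl (fun m i => instr_sem i m) m c.

Lemma runs_block p pc c m : code_at p pc c -> all plain c ->
  runs p (size c) (pc, m) (pc + size c, block_sem c m).
Proof.
move=> h hp; exists (size c) => //.
elim: c pc m h hp => [|i c IH] pc m h; first by rewrite addn0.
move=> /= /andP[hi hc].
have hn := h 0 (ltn0Sn _); rewrite addn0 /= in hn.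
have hs : step p (pc, m) = Some (pc.+1, instr_sem i m).
  by rewrite /step hn; case: i hi {h hn}.
have h1 : exec p 1 (pc, m) = (pc.+1, instr_sem i m) by rewrite /exec hs.
change (exec p (1 + size c) (pc, m) = (pc + (size c).+1, block_sem c (instr_sem i m))).
rewrite exec_add h1.
rewrite IH // ?addnS ?addSn // => j hj.
by have := h j.+1 hj; rewrite addnS addSn.
Qed.

Lemma runs_jz p pc r q m : code_at p pc [:: IJz r q] ->
  runs p 1 (pc, m) (if m r == 0 then q else pc.+1, m).
Proof.
move=> h; exists 1 => //=.
by have := h 0 (ltn0Sn _); rewrite addn0 /= => ->.
Qed.

(* Register 0 holds 0, register 1 holds 1, and register 2 holds the common
   bound [N] of all loops, which is also the base address of the heap.  The
   arrays [a < 16] are interleaved in the heap, so that they never overlap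
   whatever their lengths; array 16 stands for the cells between the registers
   and the heap, where the input is found and the output is to be left. *)
Definition rep (N : nat) (st : store) (m : nat -> nat) : Prop :=
  [/\ m 0 = 0, m 1 = 1, m 2 = N,
      forall a i, a < 16 -> m (N + 16 * i + a) = st a i &
      forall r, 40 <= r < N -> m r = st 16 r].

Definition rep_env (N d : nat) (env m : nat -> nat) : Prop :=
  forall x, x < d -> m (4 + x) = env x /\ env x < N.

(** The frame condition for code at stack height [l] inside [d] loops: only register 3, deeper
    counters and higher stack cells may change. *)
Definition keeps (d l : nat) (m m' : nat -> nat) : Prop :=
  forall r, [|| r < 3, 4 <= r < 4 + d, 12 <= r < 12 + l | 40 <= r] -> m' r = m r.

Lemma keeps_trans d l m1 m2 m3 :
  keeps d l m1 m2 -> keeps d l m2 m3 -> keeps d l m1 m3.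
Proof. by move=> h1 h2 r hr; rewrite h2 // h1. Qed.

Lemma keeps_le d l d' l' m m' : d <= d' -> l <= l' ->
  keeps d' l' m m' -> keeps d l m m'.
Proof. by move=> hd hl h r hr; apply: h; lia. Qed.

Lemma keeps_rep N d l st m m' : 40 <= N -> keeps d l m m' -> rep N st m -> rep N st m'.
Proof.
move=> hN h [h0 h1 h2 h3 h4]; split; try by rewrite h.
- by move=> a i ha; rewrite h ?h3 //; lia.
- by move=> r hr; rewrite h ?h4 //; lia.
Qed.

Lemma keeps_env N d d' l env m m' : d' <= d -> d <= 8 -> keeps d l m m' ->
  rep_env N d' env m -> rep_env N d' env m'.
Proof.
move=> hd hd8 h he x hx; have [e1 e2] := he x hx; split => //.
by rewrite h ?e1 //; lia.
Qed.

Lemma upd_eq m r x : upd m r x r = x. Proof. by rewrite /upd eqxx. Qed.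

Lemma upd_ne m r x r' : r' != r -> upd m r x r' = m r'.
Proof. by rewrite /upd => /negbTE ->. Qed.

Lemma addr_block l a N st m i : l < 28 -> a < 16 -> rep N st m -> m (12 + l) = i ->
  let m' := block_sem (addr l a) m in
  m' (12 + l) = N + 16 * i + a /\
  forall r, r != 3 -> r != 12 + l -> m' r = m r.
Proof.
move=> hl ha [h0 h1 h2 h3 h4] hi; split; last first.
  by move=> r h h'; rewrite /block_sem /= !upd_ne.
rewrite /block_sem /= /upd !eqxx.
have -> : (12 + l == 3) = false by lia.
have -> : (2 == 3) = false by [].
have -> : (2 == 12 + l) = false by lia.
rewrite h2 hi; lia.
Qed.

Lemma keeps_upd d l m r x : [&& 2 < r, ~~ (4 <= r < 4 + d), ~~ (12 <= r < 12 + l) & r < 40] ->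
  keeps d l m (upd m r x).
Proof. by move=> h r' hr'; rewrite /upd; case: eqP => // e; lia. Qed.

Lemma runs_instr p pc i c m : code_at p pc (i :: c) -> plain i ->
  runs p 1 (pc, m) (pc.+1, instr_sem i m).
Proof.
move=> h hi; have h' : code_at p pc [:: i].
  by case: (@code_at_cat p pc [:: i] c h).
have := @runs_block p pc [:: i] m h'; rewrite /= addn1 andbT; exact.
Qed.

Lemma code_at_behead p pc i c : code_at p pc (i :: c) -> code_at p pc.+1 c.
Proof. by move=> h; have [_] := @code_at_cat p pc [:: i] c h; rewrite addn1. Qed.

Lemma runs_jump p pc r q c m : code_at p pc (IJz r q :: c) ->
  runs p 1 (pc, m) (if m r == 0 then q else pc.+1, m).
Proof. by move=> h; apply: runs_jz; case: (@code_at_cat p pc [:: IJz r q] c h). Qed.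

Lemma wf_lt d l e : wf d l e -> l < 28.
Proof. by case: e => /= *; lia. Qed.

Lemma comp_ok p N e : 40 <= N -> forall d l pc env st m, d <= 8 -> wf d l e ->
  code_at p pc (comp pc l e) -> rep N st m -> rep_env N d env m ->
  exists m', [/\ runs p (cost N e) (pc, m) (pc + size (comp pc l e), m'),
                 m' (12 + l) = eval N env st e & keeps d l m m'].
Proof.
move=> hN; elim: e => [c|x|a e IH|e1 IH1 e2 IH2|e1 IH1 e2 IH2|e1 IH1 e2 IH2 e3 IH3|x e IH]
  d l pc env st m hd; cbn [wf comp eval cost] => /andP[hl hw] hc hr he.
- exists (upd m (12 + l) c); split; [|exact: upd_eq|by apply: keeps_upd; lia].
  by rewrite addn1; exact: (runs_instr m hc isT).
- exists (upd m (12 + l) (m (4 + x) + m 0)); split; [|rewrite upd_eq /=|by apply: keeps_upd; lia].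
    by rewrite addn1; exact: (runs_instr m hc isT).
  by case: hr => -> _ _ _ _; rewrite addn0; case: (he _ hw).
- case/andP: hw => ha hw; have [hc1 /code_at_cat[hc2 hc3]] := code_at_cat hc.
  have [m1 [r1 v1 k1]] := IH _ _ _ _ _ _ hd hw hc1 hr he.
  have r2 := runs_block m1 hc2 isT.
  have hr1 := keeps_rep hN k1 hr.
  have [v2 f2] := addr_block hl ha hr1 v1.
  move: (block_sem (addr l a) m1) v2 f2 r2 => m2 v2 f2 r2.
  have r3 := runs_instr m2 hc3 isT.
  eexists; split.
  + by apply: (runs_to (runs_trans (runs_trans r1 r2) r3)); rewrite ?size_cat /=; lia.
  + rewrite /= upd_eq v2; case: hr1 => h0 h1 h2 h3 h4.
    rewrite f2 ?h3 //; lia.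
  + move=> r hr'; rewrite /= upd_ne; last by lia.
    by rewrite f2 ?k1 //; lia.
- case/andP: hw => hw1 hw2; have [hc1 /code_at_cat[hc2 hc3]] := code_at_cat hc.
  have [m1 [r1 v1 k1]] := IH1 _ _ _ _ _ _ hd hw1 hc1 hr he.
  have hr1 := keeps_rep hN k1 hr.
  have he1 := keeps_env (leqnn _) hd k1 he.
  have [m2 [r2 v2 k2]] := IH2 _ _ _ _ _ _ hd hw2 hc2 hr1 he1.
  have r3 := runs_instr m2 hc3 isT.
  eexists; split.
  + by apply: (runs_to (runs_trans (runs_trans r1 r2) r3)) => //; rewrite !size_cat /=; lia.
  + by rewrite /= upd_eq v2 k2 ?v1 //; lia.
  + move=> r hr'; rewrite /= upd_ne; last by lia.
    by rewrite k2 ?k1 //; lia.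
- case/andP: hw => hw1 hw2; have [hc1 /code_at_cat[hc2 hc3]] := code_at_cat hc.
  have [m1 [r1 v1 k1]] := IH1 _ _ _ _ _ _ hd hw1 hc1 hr he.
  have hr1 := keeps_rep hN k1 hr.
  have he1 := keeps_env (leqnn _) hd k1 he.
  have [m2 [r2 v2 k2]] := IH2 _ _ _ _ _ _ hd hw2 hc2 hr1 he1.
  have r3 := runs_instr m2 hc3 isT.
  eexists; split.
  + by apply: (runs_to (runs_trans (runs_trans r1 r2) r3)) => //; rewrite !size_cat /=; lia.
  + by rewrite /= upd_eq v2 k2 ?v1 //; lia.
  + move=> r hr'; rewrite /= upd_ne; last by lia.
    by rewrite k2 ?k1 //; lia.
- case/and3P: hw => hw1 hw2 hw3.
  have [hc1 /code_at_cat[hcj /code_at_cat[hc2 /code_at_cat[hcj' hc3]]]] := code_at_cat hc.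
  have [m1 [r1 v1 k1]] := IH1 _ _ _ _ _ _ hd hw1 hc1 hr he.
  have hr1 := keeps_rep hN k1 hr.
  have he1 := keeps_env (leqnn _) hd k1 he.
  have rj := runs_jump m1 hcj; move: rj; rewrite v1.
  set c1 := comp pc l e1 in hc hc1 hcj hc2 hcj' hc3 r1 *.
  set c2 := comp (pc + size c1 + 1) l e2 in hc hc2 hcj hcj' hc3 *.
  case: eqP => hz rj.
  + have [m2 [r2 v2 k2]] := IH3 _ _ _ _ _ _ hd hw3 hc3 hr1 he1.
    exists m2; split => //; last exact: keeps_trans k1 k2.
    by apply: (runs_to (runs_trans (runs_trans r1 rj) r2)); rewrite ?size_cat /= ?size_cat /=; lia.
  + move: rj; rewrite (_ : (pc + size c1).+1 = pc + size c1 + 1) => [rj|]; last by lia.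
    have [m2 [r2 v2 k2]] := IH2 _ _ _ _ _ _ hd hw2 hc2 hr1 he1.
    have := runs_jump m2 hcj'.
    have -> : m2 0 = 0 by rewrite k2 ?k1 //; case: hr.
    rewrite eqxx => rj'.
    exists m2; split => //; last exact: keeps_trans k1 k2.
    by apply: (runs_to (runs_trans (runs_trans (runs_trans r1 rj) r2) rj')); rewrite ?size_cat /= ?size_cat /=; lia.
- case/and3P: hw => /eqP e0 hd8 hw; move: hc; rewrite {}e0 => hc {x}; have hl1 := wf_lt hw.
  set b := comp _ _ _ in hc *.
  have [hc0 hcb'] := @code_at_cat p pc [:: _; _; _; _] _ hc.
  have [hcb hce] := code_at_cat hcb'.
  have c1 := code_at_behead hc0; have c2 := code_at_behead c1.
  have c3 := code_at_behead c2.
  have e1 := code_at_behead hce; have e2 := code_at_behead e1.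
  have e3 := code_at_behead e2.
  set m0 := upd (upd m (12 + l) 0) (4 + d) 0.
  have r0 : runs p 2 (pc, m) (pc + 2, m0).
    by rewrite addn2; exact: runs_trans (runs_instr m hc0 isT) (runs_instr _ c1 isT).
  pose inv i m' := [/\ keeps d l m m', m' (4 + d) = i &
    m' (12 + l) = \max_(j < i) eval N (upd env d j) st e].
  have i0 : inv 0 m0.
    rewrite /inv /m0 big_ord0 upd_eq (@upd_ne _ _ _ (12 + l)) ?upd_eq; last by lia.
    split=> //; apply: (@keeps_trans _ _ _ (upd m (12 + l) 0)).
      by apply: keeps_upd; lia.
    by apply: keeps_upd; lia.
  have test i m' : inv i m' -> runs p 2 (pc + 2, m')
      (if i < N then pc + 4 else pc + 4 + size b + 4, upd m' 3 (N - i)).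
    move=> [k v _]; have [_ _ h2 _ _] := keeps_rep hN k hr.
    have := runs_jump (upd m' 3 (m' 2 - m' (4 + d))) c3; rewrite upd_eq h2 v => rj.
    have := runs_instr m' c2 isT; rewrite /= h2 v => ri.
    apply: (runs_to (runs_trans _ rj)); first by rewrite addn2; exact: ri.
      by [].
    by rewrite subn_eq0 ltnNge; case: leq => //=; lia.
  have iter i m' : i < N -> inv i m' -> exists2 m'', inv i.+1 m'' &
      runs p (cost N e + 6) (pc + 2, m') (pc + 2, m'').
    move=> hi hinv; have := test _ _ hinv; rewrite hi => rt.
    case: hinv => k v a; set m3 := upd m' 3 (N - i) in rt.
    have k3 : keeps d l m m3 by apply: keeps_trans k _; apply: keeps_upd; lia.
    have hr3 := keeps_rep hN k3 hr.
    have he3 : rep_env N d.+1 (upd env d i) m3.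
      move=> y hy; case: (eqVneq y d) => [->|hyd].
        by rewrite upd_eq /m3 upd_ne ?v //; lia.
      rewrite upd_ne //; have [<- ?] := he y (ltac:(lia)); split=> //.
      by rewrite k3 //; lia.
    have [m4 [r4 v4 k4]] := IH _ _ _ _ _ _ hd8 hw hcb hr3 he3.
    have f1 : m4 (12 + l) = m' (12 + l).
      by rewrite k4 /m3 ?upd_ne //; lia.
    have f2 : m4 (4 + d) = i by rewrite k4 /m3 ?upd_ne ?v //; lia.
    have f3 : m4 0 = 0 by rewrite k4 //; case: hr3.
    have f4 : m4 1 = 1 by rewrite k4 //; case: hr3.
    have r5 := runs_instr m4 hce isT; cbn [instr_sem] in r5.
    set m5 := upd m4 _ _ in r5.
    have r6 := runs_instr m5 e1 isT; cbn [instr_sem] in r6.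
    set m6 := upd m5 _ _ in r6.
    have r7 := runs_instr m6 e2 isT; cbn [instr_sem] in r7.
    set m7 := upd m6 _ _ in r7.
    have r8 := runs_jump m7 e3.
    have g0 : m7 0 = 0 by rewrite /m7 /m6 /m5 !upd_ne.
    rewrite g0 eqxx in r8.
    have k7 : keeps d l m4 m7.
      move=> r h; rewrite /m7 /m6 /m5 !upd_ne //; lia.
    exists m7.
      split.
      - apply: keeps_trans k3 (keeps_trans _ k7); apply: keeps_le k4; lia.
      - rewrite /m7 upd_eq /m6 /m5 !upd_ne ?f2 ?f4; lia.
      - rewrite /m7 /m6 upd_ne ?upd_eq /m5 ?upd_eq; last by lia.
        rewrite upd_ne; last by lia.
        rewrite v4 f1 a big_ord_recr /= /maxn; case: ltnP; lia.
    apply: (runs_to (runs_trans (runs_trans (runs_trans (runs_trans (runs_trans rt r4) r5) r6) r7) r8)); lia.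
  have loop i : i <= N -> exists2 m', inv i m' &
      runs p (2 + i * (cost N e + 6)) (pc, m) (pc + 2, m').
    elim: i => [|i IHi] hi; first by exists m0; rewrite ?mul0n ?addn0.
    have [m' inv1 ra] := IHi (ltnW hi); have [m'' inv2 rb] := iter _ _ hi inv1.
    by exists m'' => //; apply: (runs_to (runs_trans ra rb)) => //; lia.
  have [m' inv1 ra] := loop N (leqnn _); have := test _ _ inv1.
  rewrite ltnn => rt; have [k v a] := inv1.
  exists (upd m' 3 (N - N)); split.
  + apply: (runs_to (runs_trans ra rt)); first by lia.
    by rewrite /= size_cat /=; lia.
  + by rewrite upd_ne ?a //; lia.
  + by apply: keeps_trans k _; apply: keeps_upd; lia.
Qed.

Lemma rep_upd2 N st m a i x : 40 <= N -> a < 16 -> rep N st m ->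
  rep N (upd2 st a i x) (upd m (N + 16 * i + a) x).
Proof.
move=> hN ha [h0 h1 h2 h3 h4]; split; try by rewrite upd_ne //; lia.
- move=> b j hb; rewrite /upd2 -h3 // /upd.
  have -> : (N + 16 * j + b == N + 16 * i + a) = ((b == a) && (j == i)) by lia.
  by [].
- move=> r hr; rewrite /upd2 upd_ne ?h4; try lia.
  by have -> : (16 == a) = false by lia.
Qed.

Lemma rep_upd2_raw N st m i x : 40 <= i < N -> rep N st m ->
  rep N (upd2 st 16 i x) (upd m i x).
Proof.
move=> hi [h0 h1 h2 h3 h4]; split; try by rewrite upd_ne //; lia.
- move=> b j hb; rewrite /upd2 -h3 // upd_ne; last by lia.
  by have -> : (b == 16) = false by lia.
- by move=> r hr; rewrite /upd2 /upd eqxx h4.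
Qed.

Lemma rep_env_upd N d env m r x : ~~ (4 <= r < 4 + d) ->
  rep_env N d env m -> rep_env N d env (upd m r x).
Proof. by move=> hr h y hy; have [e1 e2] := h y hy; rewrite upd_ne ?e1 //; lia. Qed.

(** A command starts with an empty stack, so only the store and the active counters have to survive
    it; [keeps] is replaced by [rep] and [rep_env]. *)
Lemma compc_ok p N c : 40 <= N -> forall d pc env st m, d <= 8 -> wfc d c ->
  code_at p pc (compc pc c) -> rep N st m -> rep_env N d env m ->
  exists m', [/\ runs p (costc N c) (pc, m) (pc + size (compc pc c), m'),
                 rep N (sem N env c st) m' & rep_env N d env m'].
Proof.
move=> hN; elim: c => [a e1 e2|c1 IH1 c2 IH2|x c IH|x|x] d pc env st m hd;
  cbn [wfc compc sem costc] => hw hc hr he.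
- case/and3P: hw => ha hw1 hw2.
  have [hc1 /code_at_cat[hc2 /code_at_cat[hc3 hc4]]] := code_at_cat hc.
  have [m1 [r1 v1 k1]] := comp_ok hN hd hw1 hc1 hr he.
  have hr1 := keeps_rep hN k1 hr.
  have he1 := keeps_env (leqnn _) hd k1 he.
  have [m2 [r2 v2 k2]] := comp_ok hN hd hw2 hc2 hr1 he1.
  have hr2 := keeps_rep hN k2 hr1.
  have he2 := keeps_env (leqnn _) hd k2 he1.
  have v1' : m2 (12 + 0) = eval N env st e1 by rewrite k2 ?v1 //; lia.
  have [v3 f3] := addr_block (isT : 0 < 28) ha hr2 v1'.
  have r3 := runs_block m2 hc3 isT.
  move: (block_sem (addr 0 a) m2) v3 f3 r3 => m3 v3 f3 r3.
  have k3 : keeps d 0 m2 m3 by move=> r h; rewrite f3 //; lia.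
  have hr3 := keeps_rep hN k3 hr2.
  have he3 := keeps_env (leqnn _) hd k3 he2.
  have r4 := runs_instr m3 hc4 isT; rewrite [instr_sem _ _]/= v3 f3 // v2 in r4.
  exists (upd m3 (N + 16 * eval N env st e1 + a) (eval N env st e2)); split.
  + apply: (runs_to (runs_trans (runs_trans (runs_trans r1 r2) r3) r4)).
      by rewrite /=; lia.
    by rewrite !size_cat /=; lia.
  + exact: rep_upd2.
  + by apply: rep_env_upd; [lia|].
- case/andP: hw => hw1 hw2; have [hc1 hc2] := code_at_cat hc.
  have [m1 [r1 hr1 he1]] := IH1 _ _ _ _ _ hd hw1 hc1 hr he.
  have [m2 [r2 hr2 he2]] := IH2 _ _ _ _ _ hd hw2 hc2 hr1 he1.
  exists m2; split=> //; apply: (runs_to (runs_trans r1 r2)) => //.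
  by rewrite size_cat addnA.
- case/and3P: hw => /eqP e0 hd8 hw; move: hc; rewrite {}e0 => hc {x}.
  set b := compc (pc + 3) c in hc *.
  have [hc0 hcb'] := @code_at_cat p pc [:: _; _; _] _ hc.
  have [hcb hce] := code_at_cat hcb'.
  have c1 := code_at_behead hc0; have c2 := code_at_behead c1.
  have e1 := code_at_behead hce.
  pose F i := iteri i (fun i => sem N (upd env d i) c) st.
  pose inv i m' := [/\ rep N (F i) m', rep_env N d env m' & m' (4 + d) = i].
  have test i m' : inv i m' -> runs p 2 (pc + 1, m')
      (if i < N then pc + 3 else pc + 3 + size b + 2, upd m' 3 (N - i)).
    move=> [[_ _ h2 _ _] _ v].
    have := runs_jump (upd m' 3 (m' 2 - m' (4 + d))) c2; rewrite upd_eq h2 v => rj.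
    have := runs_instr m' c1 isT; rewrite /= h2 v => ri.
    apply: (runs_to (runs_trans _ rj)); first by rewrite addn1; exact: ri.
      by [].
    by rewrite subn_eq0 ltnNge; case: leq => //=; lia.
  have i3 i m' x : inv i m' -> inv i (upd m' 3 x).
    move=> [h1 h2 h3]; split; [|by apply: rep_env_upd => //; lia|by rewrite upd_ne //; lia].
    by apply: (@keeps_rep _ 0 0 _ m') => //; apply: keeps_upd; lia.
  have iter i m' : i < N -> inv i m' -> exists2 m'', inv i.+1 m'' &
      runs p (costc N c + 4) (pc + 1, m') (pc + 1, m'').
    move=> hi hinv; have := test _ _ hinv; rewrite hi => rt.
    have := i3 _ _ (N - i) hinv; set m3 := upd m' 3 (N - i) in rt *.
    case=> hr3 he3 v3.
    have he3' : rep_env N d.+1 (upd env d i) m3.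
      move=> y hy; case: (eqVneq y d) => [->|hyd]; first by rewrite upd_eq v3.
      by rewrite upd_ne //; apply: he3; lia.
    have [m4 [r4 hr4 he4]] := IH _ _ _ _ _ hd8 hw hcb hr3 he3'.
    have r5 := runs_instr m4 hce isT; cbn [instr_sem] in r5.
    have [f2 _] := he4 d (leqnn _); rewrite upd_eq in f2.
    have [f3 f4 _ _ _] := hr4; rewrite f2 f4 in r5.
    set m5 := upd m4 _ _ in r5.
    have r8 := runs_jump m5 e1.
    have g0 : m5 0 = 0 by rewrite /m5 upd_ne.
    rewrite g0 eqxx in r8.
    exists m5.
      split.
      - apply: (@keeps_rep _ 0 0 _ m4) => //; apply: keeps_upd; lia.
      - apply: rep_env_upd; first by lia.
        move=> y hy; have [] := he4 y (ltac:(lia)); rewrite upd_ne //; lia.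
      - by rewrite /m5 upd_eq addn1.
    apply: (runs_to (runs_trans (runs_trans (runs_trans rt r4) r5) r8)); lia.
  have i0 : inv 0 (upd m (4 + d) 0).
    split; last exact: upd_eq.
      by apply: (@keeps_rep _ 0 0 _ m) => //; apply: keeps_upd; lia.
    by apply: rep_env_upd => //; lia.
  have loop i : i <= N -> exists2 m', inv i m' &
      runs p (1 + i * (costc N c + 4)) (pc, m) (pc + 1, m').
    elim: i => [|i IHi] hi.
      by exists (upd m (4 + d) 0) => //; rewrite mul0n addn1; exact: (runs_instr m hc0).
    have [m' inv1 ra] := IHi (ltnW hi); have [m'' inv2 rb] := iter _ _ hi inv1.
    by exists m'' => //; apply: (runs_to (runs_trans ra rb)) => //; lia.
  have [m' inv1 ra] := loop N (leqnn _); have := test _ _ inv1.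
  rewrite ltnn => rt; have [hr' he' _] := i3 _ _ (N - N) inv1.
  exists (upd m' 3 (N - N)); split => //.
  apply: (runs_to (runs_trans ra rt)); first by lia.
  by rewrite /= size_cat /=; lia.
- case/andP: hw => hx _; have [ex hxN] := he x hx.
  have [hc0 /code_at_cat[hc1 /code_at_cat[hc2 hc3]]] :=
    @code_at_cat p pc [:: _; _; _] _ hc.
  have r1 := runs_instr m hc0 isT; cbn [instr_sem] in r1.
  have hc0' := code_at_behead hc0.
  have r2 := runs_instr (upd m 3 39) hc0' isT; cbn [instr_sem] in r2.
  rewrite upd_eq upd_ne ?ex in r2; last by lia.
  have r3 := runs_jump (upd (upd m 3 39) (12 + 0) (env x - 39)) (code_at_behead hc0').
  set m1 := upd (upd _ _ _) _ _ in r2 r3.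
  have k1 : keeps d 0 m m1.
    by rewrite /m1; apply: (@keeps_trans _ _ _ (upd m 3 39)); apply: keeps_upd; lia.
  have v1 : m1 (12 + 0) = env x - 39 by rewrite /m1 upd_eq.
  rewrite v1 in r3; have := runs_trans (runs_trans r1 r2) r3.
  have hr1 := keeps_rep hN k1 hr.
  have he1 := keeps_env (leqnn _) hd k1 he.
  rewrite subn_eq0 (leqNgt (env x) 39); case: ltnP => hx39 /= {}r3; last first.
    by exists m1; split => //; apply: (runs_to r3).
  have r4 := runs_block m1 hc1 isT.
  set m2 := block_sem _ m1 in r4.
  have k2 : keeps d 0 m1 m2.
    rewrite /m2 /block_sem /=.
    by apply: (@keeps_trans _ _ _ (upd m1 (12 + 0) (m1 (4 + x) - m1 1)));
      apply: keeps_upd; lia.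
  have [ex1 _] := he1 x hx.
  have v2 : m2 (12 + 0) = env x - 1.
    rewrite /m2 /= upd_ne // upd_eq ex1; by case: hr1 => _ ->.
  have w2 : m2 (12 + 1) = st 16 (env x).
    rewrite /m2 /= upd_eq !(@upd_ne _ 12); try lia.
    rewrite ex1; case: hr1 => _ _ _ _ ->; lia.
  have hr2 := keeps_rep hN k2 hr1.
  have he2 := keeps_env (leqnn _) hd k2 he1.
  have [v3 f3] := addr_block (isT : 0 < 28) (isT : 0 < 16) hr2 v2.
  have r5 := runs_block m2 hc2 isT.
  move: (block_sem (addr 0 0) m2) v3 f3 r5 => m3 v3 f3 r5.
  have k3 : keeps d 0 m2 m3 by move=> r h; rewrite f3 //; lia.
  have hr3 := keeps_rep hN k3 hr2.
  have he3 := keeps_env (leqnn _) hd k3 he2.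
  have r6 := runs_instr m3 hc3 isT; rewrite [instr_sem _ _]/= v3 f3 // w2 in r6.
  exists (upd m3 (N + 16 * (env x - 1) + 0) (st 16 (env x))); split.
  + apply: (runs_to (runs_trans (runs_trans (runs_trans _ r4) r5) r6)).
    * by apply: (runs_to r3); [exact: leqnn | rewrite /=; lia].
    * by [].
    * by rewrite /=; lia.
  + exact: rep_upd2.
  + by apply: rep_env_upd; [lia|].
- case/andP: hw => hx _; have [ex hxN] := he x hx.
  have [hc0 /code_at_cat[hc1 /code_at_cat[hc2 hc3]]] :=
    @code_at_cat p pc [:: _; _; _] _ hc.
  have r1 := runs_instr m hc0 isT; cbn [instr_sem] in r1.
  have hc0' := code_at_behead hc0.
  have r2 := runs_instr (upd m 3 39) hc0' isT; cbn [instr_sem] in r2.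
  rewrite upd_eq upd_ne ?ex in r2; last by lia.
  have r3 := runs_jump (upd (upd m 3 39) (12 + 0) (env x - 39)) (code_at_behead hc0').
  set m1 := upd (upd _ _ _) _ _ in r2 r3.
  have k1 : keeps d 0 m m1.
    by rewrite /m1; apply: (@keeps_trans _ _ _ (upd m 3 39)); apply: keeps_upd; lia.
  have v1 : m1 (12 + 0) = env x - 39 by rewrite /m1 upd_eq.
  rewrite v1 in r3; have := runs_trans (runs_trans r1 r2) r3.
  have hr1 := keeps_rep hN k1 hr.
  have he1 := keeps_env (leqnn _) hd k1 he.
  rewrite subn_eq0 (leqNgt (env x) 39); case: ltnP => hx39 /= {}r3; last first.
    by exists m1; split => //; apply: (runs_to r3).
  have r4 : runs p 1 (_, m1) (_, upd m1 (12 + 0) (m1 (4 + x) + m1 0)) :=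
    runs_block m1 hc1 isT.
  set m2 := upd _ _ _ in r4.
  have k2 : keeps d 0 m1 m2 by rewrite /m2; apply: keeps_upd; lia.
  have [ex1 _] := he1 x hx.
  have v2 : m2 (12 + 0) = env x.
    rewrite /m2 /= upd_eq ex1; by case: hr1 => ->; rewrite addn0.
  have hr2 := keeps_rep hN k2 hr1.
  have he2 := keeps_env (leqnn _) hd k2 he1.
  have [v3 f3] := addr_block (isT : 0 < 28) (isT : 0 < 16) hr2 v2.
  have r5 := runs_block m2 hc2 isT.
  move: (block_sem (addr 0 0) m2) v3 f3 r5 => m3 v3 f3 r5.
  have k3 : keeps d 0 m2 m3 by move=> r h; rewrite f3 //; lia.
  have hr3 := keeps_rep hN k3 hr2.
  have he3 := keeps_env (leqnn _) hd k3 he2.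
  have r6 := runs_instr m3 hc3 isT; rewrite [instr_sem _ _]/= v3 in r6.
  have -> : st 0 (env x) = m3 (N + 16 * env x + 0) by case: hr3 => _ _ _ ->.
  set m4 := upd _ _ _ in r6.
  have k4 : keeps d 0 m3 m4 by rewrite /m4; apply: keeps_upd; lia.
  have hr4 := keeps_rep hN k4 hr3.
  have he4 := keeps_env (leqnn _) hd k4 he3.
  have [ex4 _] := he4 x hx.
  have r7 := runs_instr m4 (code_at_behead hc3) isT.
  rewrite [instr_sem _ _]/= ex4 (_ : m4 (12 + 1) = m3 (m3 (12 + 0))) in r7; last first.
    by rewrite /m4 upd_eq v3.
  rewrite v3 in r7.
  eexists; split.
  + apply: (runs_to (runs_trans (runs_trans (runs_trans (runs_trans _ r4) r5) r6) r7)).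
    * by apply: (runs_to r3); [exact: leqnn | rewrite /=; lia].
    * by [].
    * by rewrite /=; lia.
  + by apply: rep_upd2_raw => //; lia.
  + by apply: rep_env_upd; [lia|].
Qed.

(** * Polynomial bounds on the cost *)

Definition polyb (f : nat -> nat) : Prop :=
  exists c d, forall N, 0 < N -> f N <= c * N ^ d.

Lemma polyb_const a : polyb (fun=> a).
Proof. by exists a, 0 => N _; rewrite expn0 muln1. Qed.

Lemma polyb_id : polyb (fun N => N).
Proof. by exists 1, 1 => N _; rewrite expn1 mul1n. Qed.

Lemma polyb_add f g : polyb f -> polyb g -> polyb (fun N => f N + g N).
Proof.
move=> [c [d h]] [c' [d' h']]; exists (c + c'), (d + d') => N hN.
rewrite mulnDl leq_add //.
  by apply: leq_trans (h N hN) _; rewrite leq_mul2l leq_pexp2l ?leq_addr ?orbT.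
by apply: leq_trans (h' N hN) _; rewrite leq_mul2l leq_pexp2l ?leq_addl ?orbT.
Qed.

Lemma polyb_mul f g : polyb f -> polyb g -> polyb (fun N => f N * g N).
Proof.
move=> [c [d h]] [c' [d' h']]; exists (c * c'), (d + d') => N hN.
by rewrite expnD mulnACA leq_mul ?h ?h'.
Qed.

Lemma cost_polyb e : polyb (cost^~ e).
Proof.
elim: e => [c|x|a e IH|e1 IH1 e2 IH2|e1 IH1 e2 IH2|e1 IH1 e2 IH2 e3 IH3|x e IH] /=;
  repeat (apply: polyb_add || apply: polyb_mul || apply: polyb_const
          || apply: polyb_id || assumption).
Qed.

Lemma costc_polyb c : polyb (costc^~ c).
Proof.
elim: c => [a e1 e2|c1 IH1 c2 IH2|x c IH|x|x] /=;
  repeat (apply: polyb_add || apply: polyb_mul || apply: polyb_const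
          || apply: polyb_id || apply: cost_polyb || assumption).
Qed.

(* Every fixed register may hold a part of the input, and only the length of
   the input is known.  Doubling the length in place gives the address of a
   free cell, which makes room without any spare register. *)
Fixpoint save_regs (k : nat) : seq instr :=
  if k is k'.+1 then save_regs k' ++ [:: IAdd 0 0 1; IStore 0 k'.+2] else [::].

(** Register 1 is saved first, because it then holds the stride 16. After 38 strides register 0
    contains [N + 608], from which [N] is recovered. *)
Definition prologue : seq instr :=
  [:: IAdd 0 0 0; IAdd 0 0 0; IAdd 0 0 0; IAdd 0 0 0; IStore 0 1; IConst 1 16] ++
  save_regs 38 ++
  [:: IConst 1 608; ISub 2 0 1; IConst 0 0; IConst 1 1].

Fixpoint restore_regs (k : nat) : seq instr :=
  if k is k'.+1 then [:: ILoad k'.+2 0; ISub 0 0 1] ++ restore_regs k' else [::].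

(** The walk starts at cell 39 of array 0, which is 624 above [N], and goes down, so that the
    pointer and the stride in registers 0 and 1 are the last to receive their output. *)
Definition epilogue_pos : seq instr :=
  [:: IConst 1 624; IAdd 0 2 1; IConst 1 16] ++ restore_regs 38 ++
  [:: ISub 0 0 1; ILoad 0 0; IConst 1 1].

Definition epilogue (pc : nat) : seq instr :=
  [:: IConst 3 16; IAdd 3 3 2; ILoad 3 3] ++
  [:: IJz 3 (pc + 4 + size epilogue_pos + 1)] ++
  epilogue_pos ++ [:: IHalt] ++ [:: IConst 1 0; IConst 0 1] ++ [:: IHalt].

Definition whole_cmd (c : cmd) : cmd :=
  CSeq (CFor 0 (CIn 0)) (CSeq c (CFor 0 (COut 0))).

Definition compile (c : cmd) : program :=
  let b := compc (size prologue) (whole_cmd c) in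
  prologue ++ b ++ epilogue (size prologue + size b).

Lemma block_sem_cat c1 c2 m : block_sem (c1 ++ c2) m = block_sem c2 (block_sem c1 m).
Proof. exact: foldl_cat. Qed.

Lemma save_regs_ok k B m : 48 <= B -> m 0 = B -> m 1 = 16 -> k <= 38 ->
  let m' := block_sem (save_regs k) m in
  [/\ m' 0 = B + 16 * k, m' 1 = 16,
      forall j, 0 < j <= k -> m' (B + 16 * j) = m j.+1 &
      forall r, (2 <= r < B) || (r == B) -> m' r = m r].
Proof.
move=> hB h0 h1; elim: k => [|k IH] hk.
  by split=> //=; rewrite ?h0 ?muln0 ?addn0 // => j; lia.
rewrite [save_regs _]/= block_sem_cat; have [a0 a1 a2 a3] := IH (ltnW hk).
set m1 := block_sem (save_regs k) m in a0 a1 a2 a3 *.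
have e0 : m1 0 + m1 1 = B + 16 * k.+1 by rewrite a0 a1; lia.
rewrite /block_sem /= upd_eq e0 (@upd_ne m1 0 _ k.+2) // a3; last by lia.
split.
- by rewrite upd_ne ?upd_eq //; lia.
- by rewrite !upd_ne ?a1 //; lia.
- move=> j hj; case: (eqVneq j k.+1) => [->|hne]; first by rewrite upd_eq.
  by rewrite !upd_ne ?a2 //; lia.
- by move=> r hr; rewrite !upd_ne ?a3 //; lia.
Qed.

Lemma prologue_ok m L : 3 <= L -> m 0 = L ->
  let N := 16 * L in
  let m' := block_sem prologue m in
  [/\ m' 0 = 0, m' 1 = 1, m' 2 = N,
      forall j, j < 39 -> m' (N + 16 * j) = m j.+1 &
      forall r, 40 <= r < N -> m' r = m r].
Proof.
move=> hL h0 N; rewrite /prologue block_sem_cat block_sem_cat.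
set m1 := block_sem [:: IAdd 0 0 0; _; _; _; _; _] m.
have e1 : m1 = upd (upd (upd (upd (upd (upd m 0 (L + L)) 0 (L + L + (L + L))) 0
    (L + L + (L + L) + (L + L + (L + L)))) 0 N) N (m 1)) 1 16.
  rewrite /m1 /block_sem /= h0 !upd_eq.
  have -> : L + L + (L + L) + (L + L + (L + L)) +
            (L + L + (L + L) + (L + L + (L + L))) = N by rewrite /N; lia.
  by rewrite !(@upd_ne _ 0 _ 1).
have hN : 48 <= N by rewrite /N; lia.
have b0 : m1 0 = N by rewrite e1 upd_ne // upd_ne ?upd_eq //; lia.
have b1 : m1 1 = 16 by rewrite e1 upd_eq.
have b2 : m1 N = m 1 by rewrite e1 upd_ne ?upd_eq //; lia.
have b3 r : 2 <= r -> r < N -> m1 r = m r.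
  by move=> h h'; rewrite e1 !upd_ne //; lia.
have [c0 c1 c2 c3] := save_regs_ok hN b0 b1 (leqnn 38).
move: (block_sem (save_regs 38) m1) c0 c1 c2 c3 => m2 c0 c1 c2 c3.
set m3 := block_sem _ m2.
have e3 : m3 = upd (upd (upd (upd m2 1 608) 2 N) 0 0) 1 1.
  rewrite /m3 /block_sem; cbn [foldl instr_sem].
  rewrite upd_eq (@upd_ne m2 1 _ 0) // c0.
  by have -> : N + 16 * 38 - 608 = N by lia.
rewrite e3.
split.
- by rewrite upd_ne // upd_eq.
- by rewrite upd_eq.
- by rewrite upd_ne // upd_ne // upd_eq.
- move=> j hj; rewrite !upd_ne; try lia.
  case: (posnP j) => [->|hj0]; first by rewrite muln0 addn0 c3 ?eqxx ?orbT.
  by rewrite c2 ?b3 //; lia.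
- by move=> r hr; rewrite !upd_ne ?c3 ?b3 //; lia.
Qed.

Lemma restore_regs_ok k N m : 48 <= N -> m 0 = N + 16 * k.+1 -> m 1 = 16 -> k <= 38 ->
  let m' := block_sem (restore_regs k) m in
  [/\ m' 0 = N + 16, m' 1 = 16,
      forall r, 2 <= r < k.+2 -> m' r = m (N + 16 * r) &
      forall r, k.+2 <= r -> m' r = m r].
Proof.
move=> hN; elim: k m => [|k IH] m h0 h1 hk; first by split=> // r; lia.
rewrite [restore_regs _]/= -/([:: _; _] ++ _) block_sem_cat.
set m1 := block_sem [:: _; _] m.
have e1 : m1 = upd (upd m k.+2 (m (N + 16 * k.+2))) 0 (N + 16 * k.+1).
  rewrite /m1 /block_sem /= !(@upd_ne m k.+2) // h0 h1.
  have -> // : N + 16 * k.+2 - 16 = N + 16 * k.+1 by lia.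
have b0 : m1 0 = N + 16 * k.+1 by rewrite e1 upd_eq.
have b1 : m1 1 = 16 by rewrite e1 !upd_ne.
have [c0 c1 c2 c3] := IH m1 b0 b1 (ltnW hk).
split=> // r hr.
- case: (eqVneq r k.+2) => [->|hne].
    by rewrite c3 // e1 upd_ne ?upd_eq.
  rewrite c2; last by lia.
  by rewrite e1 !upd_ne //; lia.
- by rewrite c3 ?e1 ?upd_ne //; lia.
Qed.

Lemma epilogue_pos_ok N st m : 48 <= N -> rep N st m ->
  let m' := block_sem epilogue_pos m in
  [/\ m' 0 = st 0 0, m' 1 = 1,
      forall r, 2 <= r < 40 -> m' r = st 0 r &
      forall r, 40 <= r < N -> m' r = st 16 r].
Proof.
move=> hN [h0 h1 h2 h3 h4]; rewrite /epilogue_pos block_sem_cat block_sem_cat.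
set m1 := block_sem [:: _; _; _] m.
have e1 : m1 = upd (upd (upd m 1 624) 0 (N + 624)) 1 16.
  by rewrite /m1 /block_sem /= upd_eq (@upd_ne m 1) // h2.
have b0 : m1 0 = N + 16 * 39 by rewrite e1 upd_ne // upd_eq; lia.
have b1 : m1 1 = 16 by rewrite e1 upd_eq.
have [c0 c1 c2 c3] := restore_regs_ok hN b0 b1 (leqnn 38).
move: (block_sem (restore_regs 38) m1) c0 c1 c2 c3 => m2 c0 c1 c2 c3.
rewrite /block_sem /= upd_eq c0 c1 addnK.
split.
- rewrite upd_ne // upd_eq upd_ne ?c3 ?e1 ?upd_ne; try lia.
  by rewrite -h3 // muln0 !addn0.
- by rewrite upd_eq.
- move=> r hr; rewrite !upd_ne ?c2 ?e1 ?upd_ne; try lia.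
  by rewrite -h3 // addn0.
- by move=> r hr; rewrite !upd_ne ?c3 ?e1 ?upd_ne ?h4 //; lia.
Qed.

Lemma exec_halted p k k' s : k <= k' -> halted p (exec p k s) ->
  exec p k' s = exec p k s.
Proof.
move=> hk; rewrite -(subnKC hk) exec_add /halted.
case: (k' - k) => //= j; by case: step.
Qed.

(* Cell 1 tells whether there is a solution, and cell 0 is the output length. *)
Definition outval (o : nat -> nat) : seq nat :=
  if o 1 == 0 then [:: 0] else 1 :: mkseq (fun i => o i.+2) (o 0).-1.

Lemma in_loop N env st i : 40 <= N -> i <= N ->
  let st' := iteri i (fun i => sem N (upd env 0 i) (CIn 0)) st in
  (forall j, st' 0 j = if 39 <= j < i.-1 then st 16 j.+1 else st 0 j) /\
  forall r, st' 16 r = st 16 r.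
Proof.
move=> hN; elim: i => [|i IH] hi; first by split=> // j; case: ifP => //; lia.
rewrite [iteri _ _ _]/=; have [a b] := IH (ltnW hi); rewrite upd_eq.
case: ltnP => hi'; last first.
  by split=> // j; rewrite a; case: ifP; case: ifP => //; lia.
rewrite /upd2; split=> [j|r]; last by rewrite /= b.
rewrite eqxx /= b; case: eqP => [->|hne].
  case: ifP; last by lia.
  by move=> _; congr (st _ _); lia.
rewrite a; case: ifP; case: ifP => //; lia.
Qed.

Lemma out_loop N env st i : 40 <= N -> i <= N ->
  let st' := iteri i (fun i => sem N (upd env 0 i) (COut 0)) st in
  (forall j, st' 0 j = st 0 j) /\
  forall r, 40 <= r < i -> st' 16 r = st 0 r.
Proof.
move=> hN; elim: i => [|i IH] hi; first by split=> // r; lia.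
rewrite [iteri _ _ _]/=; have [a b] := IH (ltnW hi); rewrite upd_eq.
case: ltnP => hi'; last by split=> // r hr; rewrite b //; lia.
rewrite /upd2; split=> [j|r hr] //=; rewrite a.
by case: eqP => [->//|hne]; rewrite b //; lia.
Qed.

(** Of the store on which [c] starts, only array 0 is described, hence the existential. The output
    length has to stay below [N] because the final copying loop reaches no further. *)
Theorem compile_ok (c : cmd) : wfc 0 c -> exists cc dd, forall inp : seq nat,
  3 <= size inp ->
  let N := 16 * size inp in
  exists2 st : store, (forall i, i < N.-1 -> st 0 i = nth 0 inp i) &
  let o := sem N (fun=> 0) c st 0 in
  0 < o 0 < N ->
  let s := exec (compile c) (cc * insize inp ^ dd + cc) (init inp) in
  halted (compile c) s /\ output s = outval o.
Proof.
move=> hwc; have [c1 [d1 hcost]] := costc_polyb (whole_cmd c).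
pose K := size prologue + (size (epilogue 0)).+1.
(* The factor [16 ^ d1] comes from [N = 16 * size inp], and [K] pays for the code before and after
   the command. *)
exists (c1 * 16 ^ d1 + K), d1 => inp hinp N.
have hN : 48 <= N by rewrite /N; lia.
have hN40 : 40 <= N by lia.
set p := compile c; set m0 := (init inp).2.
have hp : code_at p 0 p by [].
have [hc1 /code_at_cat[hc2 hc3]] := code_at_cat hp.
rewrite !add0n in hc2 hc3.
have pl1 : all plain prologue by vm_compute.
have r1 := runs_block m0 hc1 pl1; rewrite add0n in r1.
have [a0 a1 a2 a3 a4] := @prologue_ok m0 (size inp) hinp (erefl _).
move: (block_sem prologue m0) r1 a0 a1 a2 a3 a4 => m1 r1 a0 a1 a2 a3 a4.
pose st1 : store := fun a i => if a == 16 then m1 i else m1 (N + 16 * i + a).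
have rep1 : rep N st1 m1.
  split=> // a i ha; rewrite /st1; by have -> : (a == 16) = false by lia.
have hw : wfc 0 (whole_cmd c) by rewrite /= hwc.
have renv : rep_env N 0 (fun=> 0) m1 by [].
have [m2 [r2 rep2 _]] := compc_ok hN40 (isT : 0 <= 8) hw hc2 rep1 renv.
have [ein _] := in_loop (fun=> 0) st1 hN40 (leqnn N).
have eqst : sem N (fun=> 0) (whole_cmd c) st1 =
  iteri N (fun i => sem N (upd (fun=> 0) 0 i) (COut 0))
    (sem N (fun=> 0) c (iteri N (fun i => sem N (upd (fun=> 0) 0 i) (CIn 0)) st1)).
  by [].
rewrite eqst in rep2.
set st2 := iteri N (fun i => sem N (upd (fun=> 0) 0 i) (CIn 0)) st1 in ein rep2 *.
exists st2.
  move=> i hi; rewrite ein; case: ifP => hi39.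
    rewrite /st1 /= a4; last by lia.
    by rewrite /m0 /=.
  rewrite /st1 /= addn0 a3; last by lia.
  by rewrite /m0 /=.
move=> o ho; set s := exec _ _ _.
have [eo eo'] := out_loop (fun=> 0) (sem N (fun=> 0) c st2) hN40 (leqnn N).
set st3 := iteri N _ _ in rep2 eo eo'.
set q := size prologue + size _ in hc3.
have r2' : runs p (costc N (whole_cmd c)) (size prologue, m1) (q, m2) := r2.
have [he1 /code_at_cat[he2 /code_at_cat[he3 /code_at_cat[he4 /code_at_cat[he5 he6]]]]] :=
  @code_at_cat p q [:: _; _; _] _ hc3.
have r3 := runs_block m2 he1 isT.
set m3 := block_sem _ m2 in r3.
have v3 : m3 3 = o 1.
  case: rep2 => h0 h1 h2 h3 h4.
  rewrite /m3 /block_sem /= !upd_eq !upd_ne ?h2; try lia.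
  have := h3 0 1 isT; rewrite eo -/o => <-; congr m2; lia.
have k3 : keeps 0 0 m2 m3.
  move=> r hr; rewrite /m3 /block_sem /= !upd_ne //; lia.
have rep3 := keeps_rep hN40 k3 rep2.
have r4 := runs_jz m3 he2.
have halt q' m' : code_at p q' [:: IHalt] -> halted p (q', m').
  by move=> /(_ 0 (ltn0Sn _)); rewrite addn0 /halted /step => ->.
have fin m' q' b : runs p b (q, m2) (q', m') -> halted p (q', m') ->
    b <= (size (epilogue 0)).+1 -> s = (q', m').
  move=> r hh hb; have [k hk ek] := runs_trans (runs_trans r1 r2') r.
  have eini : (0, m0) = init inp by [].
  rewrite -ek eini; apply: exec_halted; last by rewrite -eini ek.
  apply: leq_trans hk _.
  have hc := hcost N (ltac:(lia)).
  have hle : N ^ d1 <= 16 ^ d1 * insize inp ^ d1.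
    rewrite -expnMn; case: (d1) => [|d]; rewrite ?expn0 // leq_exp2r //.
    by rewrite leq_mul2l /insize leq_addr.
  have hmul : c1 * N ^ d1 <= c1 * 16 ^ d1 * insize inp ^ d1.
    by rewrite -mulnA leq_mul2l hle orbT.
  have eK : K = size prologue + (size (epilogue 0)).+1 by [].
  clearbody K; move: (size prologue) (size (epilogue 0)) eK hb => u v eK hb.
  rewrite mulnDl; move: (K * _) => z; lia.
rewrite v3 in r4; have := runs_trans r3 r4; rewrite /outval.
case: (o 1 == 0) => r5.
- have r6 := runs_block m3 he5 isT; set m4 := block_sem _ m3 in r6.
  have eq1 : q + 4 + size epilogue_pos + 1 =
    q + size [:: IConst 3 16; IAdd 3 3 2; ILoad 3 3] + 1 + size epilogue_pos + 1.
    by rewrite /=; lia.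
  rewrite eq1 in r5; have r7 := runs_trans r5 r6.
  have hh := halt _ m4 he6.
  by rewrite (fin _ _ _ r7 hh).
- have r5' : runs p (size [:: IConst 3 16; IAdd 3 3 2; ILoad 3 3] + 1) (q, m2)
      (q + size [:: IConst 3 16; IAdd 3 3 2; ILoad 3 3] + 1, m3).
    by rewrite [X in (X, m3)]addn1.
  have pl2 : all plain epilogue_pos by vm_compute.
  have r6 := runs_block m3 he3 pl2.
  have [b0 b1 b2 b3] := epilogue_pos_ok hN rep3.
  move: (block_sem epilogue_pos m3) r6 b0 b1 b2 b3 => m4 r6 b0 b1 b2 b3.
  have r7 := runs_trans r5' r6; have hh := halt _ m4 he4.
  rewrite (fin _ _ _ r7 hh) //; split=> //.
  rewrite /output /= b0 eo -/o.
  have -> : (o 0 = (o 0).-1.+1) by lia.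
  apply: (@eq_from_nth _ 0) => [|i]; first by rewrite size_mkseq [RHS]/= size_mkseq.
  rewrite size_mkseq => hi; rewrite nth_mkseq //.
  case: i hi => [|i] hi; first by rewrite b1.
  rewrite [RHS]nth_mkseq //; case: (ltnP i 38) => h38.
    by rewrite b2 // eo.
  by rewrite b3 ?eo' //; lia.
Qed.

(** * Arrival times in a tree *)

Lemma has_tedgeC E u w t : has_tedge E u w t = has_tedge E w u t.
Proof. by rewrite /has_tedge orbC. Qed.

Lemma sedgeP E u w : reflect (exists t, has_tedge E u w t) (sedge E u w).
Proof.
apply: (iffP hasP) => [[[[a b] t] hin] /orP[/andP[/eqP<- /eqP<-]|/andP[/eqP<- /eqP<-]]|[t]].
- by exists t; rewrite /has_tedge hin.
- by exists t; rewrite /has_tedge hin orbT.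
- by case/orP => h; [exists (u, w, t)|exists (w, u, t)]; rewrite // !eqxx ?orbT.
Qed.

Lemma sedgeC E u w : sedge E u w = sedge E w u.
Proof.
by apply/sedgeP/sedgeP => -[t ht]; exists t; rewrite has_tedgeC.
Qed.

(** * Simple paths and the two sides of an edge *)

Section Tree.

Variables (n : nat) (E : seq tedge).
Hypotheses (wfE : wf_tgraph n E) (treeE : is_tree n E).

Local Notation adj := (sedge E).

Lemma tedge_wf u w t : has_tedge E u w t -> [&& u < n, w < n, u != w & 0 < t].
Proof.
by case/orP => /(allP wfE)/and4P[h1 h2 h3 h4]; apply/and4P; split; rewrite // eq_sym.
Qed.

Lemma adj_wf u w : adj u w -> [&& u < n, w < n & u != w].
Proof. by case/sedgeP => t /tedge_wf /and4P[-> -> -> _]. Qed.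

Definition spath (c : seq nat) : bool := uniq c && sorted adj c.

Lemma spath_cons v c : spath (v :: c) -> spath c.
Proof. by case/andP; rewrite cons_uniq => /andP[_ u] /path_sorted s; rewrite /spath u. Qed.

Lemma spath_adj v u c : spath (v :: u :: c) -> adj v u.
Proof. by case/andP => _ /andP[]. Qed.

Lemma spath_neq v u w c : spath [:: v, u, w & c] -> w != v.
Proof.
case/andP; rewrite cons_uniq !inE !negb_or => /andP[/and3P[_ h _] _] _.
by rewrite eq_sym.
Qed.

(* Acyclicity is used through this lemma only: a simple path that is extended
   without backtracking stays simple. *)
Lemma spath_ext z v u c : spath (v :: u :: c) -> adj z v -> z != u ->
  spath (z :: v :: u :: c).
Proof.
case/andP => hu hs hz hzu; have /and3P[_ _ hzv] := adj_wf hz.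
have hsort : sorted adj (z :: v :: u :: c) by rewrite /= hz.
rewrite /spath cons_uniq hu hsort !andbT !inE !negb_or hzv hzu /=; apply/negP => hin.
case/splitPr: hin hu hs => c1 c2 hu hs.
have [_ [_ hac]] := treeE.
have hs1 : path adj v (u :: rcons c1 z).
  move: hs; rewrite -cat_rcons -[sorted _ _]/(path adj v ((u :: rcons c1 z) ++ c2)).
  by rewrite cat_path => /andP[].
have hu1 : uniq [:: v, u & rcons c1 z].
  move: hu; rewrite -cat_rcons -[_ :: _]/([:: v, u & rcons c1 z] ++ c2).
  by rewrite cat_uniq => /andP[].
have hcy : cycle adj [:: v, u & rcons c1 z].
  by rewrite /cycle rcons_path hs1 /= last_rcons.
apply: (negP (hac [:: v, u & rcons c1 z] _ hu1 _)) => //.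
- apply/allP => x hx.
  have: adj x (next [:: v, u & rcons c1 z] x) by exact: next_cycle.
  by case/adj_wf/andP.
- by rewrite /= size_rcons.
Qed.

Lemma spath_all v u c : spath (v :: u :: c) -> all (fun x => x < n) (v :: u :: c).
Proof.
elim: c v u => [|w c IH] v u h; have /and3P[hv hu _] := adj_wf (spath_adj h).
  by rewrite /= hv hu.
by rewrite /= hv; apply: IH; exact: spath_cons h.
Qed.

Lemma spath_size v u c : spath (v :: u :: c) -> (size c).+2 <= n.
Proof.
move=> h; have /allP ha := spath_all h; case/andP: h => hu _.
rewrite -(size_iota 0 n) -[(size c).+2]/(size (v :: u :: c)); apply: uniq_leq_size => //.
by move=> x /ha; rewrite mem_iota.
Qed.

Lemma spath_rev c : spath c -> spath (rev c).
Proof.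
case/andP => hu hs; rewrite /spath rev_uniq hu rev_sorted /=.
by rewrite (eq_sorted (_ : _ =2 adj)) // => x y; rewrite sedgeC.
Qed.

(** Removing the edge between [u] and [v] leaves [s] in the component of [u]. *)
Definition side (s u v : nat) : Prop :=
  exists2 c, spath (v :: u :: c) & last u c = s.

Lemma side_adj s u v : side s u v -> adj u v.
Proof. by case=> c /spath_adj; rewrite sedgeC. Qed.

Lemma spath_pair u v : adj u v -> spath [:: v; u].
Proof.
move=> h; have /and3P[_ _ huv] := adj_wf h.
by rewrite /spath /= sedgeC h inE eq_sym huv.
Qed.

Lemma side_self u v : adj u v -> side u u v.
Proof.
by move=> h; exists [::] => //; exact: spath_pair.
Qed.

Lemma side_ext s u v z : side s u v -> adj v z -> z != u -> side s v z.
Proof. by case=> c hc hl hv hz; exists (u :: c) => //; apply: spath_ext; rewrite // sedgeC. Qed.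

Lemma side_neq s u v : side s u v -> s != v.
Proof.
case=> c /andP[/andP[hv _] _] <-; apply: contraNneq hv => <-.
exact: mem_last.
Qed.

(** Slide the edge along the first path towards [s]: both memberships survive each step until [s] is
    an end of the edge, where [side_neq] refuses one of them. *)
Lemma side_excl s u v : side s u v -> side s v u -> False.
Proof.
case=> c; elim: c u v => [|w c IH] u v hc hl h.
  by have := side_neq h; rewrite -hl eqxx.
have hwv : w != v.
  exact: spath_neq hc.
have huw : adj u w := spath_adj (spath_cons hc).
exact: (IH w u (spath_cons hc) hl (side_ext h huw hwv)).
Qed.

Lemma spath_exists s v : s < n -> v < n ->
  exists2 c, spath (v :: c) & last v c = s.
Proof.
move=> hs hv; have [_ [hcon _]] := treeE.
have [p /andP[hp /eqP hl]] := hcon v s hv hs.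
case/shortenP: hp hl => p' hp' hu _ hl.
by exists p' => //; rewrite /spath hu.
Qed.

Lemma side_total s u v : s < n -> adj u v -> side s u v \/ side s v u.
Proof.
move=> hs huv; have /and3P[hu hv _] := adj_wf huv.
have [[|z c] hc hl] := spath_exists hs hu.
  by left; rewrite -hl; exact: side_self.
case: (eqVneq z v) => [e|hz]; first by right; exists c; rewrite -?e.
left; exists (z :: c) => //; apply: spath_ext; rewrite // 1?sedgeC // eq_sym //.
Qed.

(** Shorten or extend the path from [v] to [a] by the edge to [b]. Only removing that edge itself
    separates its ends, so every other edge has both of them on the same side. *)
Lemma side_shift a b u v : adj a b -> side a u v ->
  side b u v \/ (u = a /\ v = b).
Proof.
move=> hab [c hc hl].
have hr := spath_rev hc.
have [d ed] : exists d, rev [:: v, u & c] = a :: d.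
  by exists (rev (v :: belast u c)); rewrite -rev_rcons rcons_cons -hl -lastI.
rewrite ed in hr.
have ec : [:: v, u & c] = rcons (rev d) a by rewrite -rev_cons -ed revK.
case: d ed hr ec => [|x d] ed hr ec; first by move: (congr1 size ec).
case: (eqVneq b x) => [ebx|hbx].
- rewrite -ebx rev_cons in ec hr *.
  case/lastP: c hl ec {hc ed} => [|c z] /= hl ec.
    right; move: ec; rewrite -cats1 -cats1 -catA /=.
    by case: (rev d) => [[-> ->] //|y [|? [|? ?]] //=].
  left; move: ec; rewrite -!rcons_cons => /rcons_inj[ec _].
  exists c; last by rewrite -[last u c]/(last 0 [:: v, u & c]) ec last_rcons.
  rewrite ec -rev_cons; apply: spath_rev; exact: spath_cons hr.
- left; have := spath_ext hr (_ : adj b a) hbx; rewrite sedgeC => /(_ hab) hr'.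
  have := spath_rev hr'; rewrite rev_cons rev_cons -rev_cons -ed revK => h.
  by exists (rcons c b); rewrite ?last_rcons // -!rcons_cons.
Qed.

(** * Least times under given lower bounds *)

Definition sup_in (Q : nat -> nat) (x : nat -> nat -> nat) (u v : nat) : nat :=
  maxn (Q u) (\max_(w < n | [&& adj w u, val w != v & 0 < x w u]) (x w u).+1).

Lemma sup_in_le Q x u v b :
  sup_in Q x u v <= b <->
  Q u <= b /\ forall w, adj w u -> w != v -> 0 < x w u -> x w u < b.
Proof.
rewrite /sup_in geq_max; split.
  case/andP=> -> /bigmax_leqP h; split=> // w hw hwv hx.
  have /and3P[hwn _ _] := adj_wf hw.
  by apply: (h (Ordinal hwn)); rewrite /= hw hwv hx.
case=> -> h /=; apply/bigmax_leqP => w /and3P[h1 h2 h3]; exact: h.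
Qed.

(** Time 0 encodes that no source lies behind the edge, and it stays 0 whatever [lb] says. The 1
    that [Q] gives to a source starts the propagation and costs nothing, as labels are positive. *)
Definition relax Q (lb x : nat -> nat -> nat) (u v : nat) : nat :=
  if sup_in Q x u v == 0 then 0 else maxn (sup_in Q x u v) (lb u v).

(** With zero bounds the same iteration also serves as a reachability test, for the sources and for
    the ends of a center. *)
Definition arrive (r : nat) Q lb : nat -> nat -> nat :=
  iter r (relax Q lb) (fun _ _ => 0).

Lemma sup_in_pos Q x u v : 0 < sup_in Q x u v ->
  0 < Q u \/ exists w, [/\ adj w u, w != v & 0 < x w u].
Proof.
move=> h; case: (posnP (Q u)) => [q0|]; last by left.
right; case: (pickP [pred w : 'I_n | [&& adj w u, val w != v & 0 < x w u]]) => [w /and3P[]|hno].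
  by exists w.
suff : sup_in Q x u v <= 0 by lia.
apply/sup_in_le; split; first by rewrite q0.
move=> w h1 h2 h3; have /and3P[hwn _ _] := adj_wf h1.
by have := hno (Ordinal hwn); rewrite /= h1 h2 h3.
Qed.

Lemma sup_in_ge Q x u v w : adj w u -> w != v -> 0 < x w u -> x w u < sup_in Q x u v.
Proof. by move=> h1 h2 h3; have [h _] := sup_in_le Q x u v (sup_in Q x u v); apply h. Qed.

Lemma sup_in_geQ Q x u v : Q u <= sup_in Q x u v.
Proof. exact: leq_maxl. Qed.

Lemma relax_pos Q lb x u v : (0 < relax Q lb x u v) = (0 < sup_in Q x u v).
Proof.
rewrite /relax; case: (posnP (sup_in Q x u v)) => // h.
by rewrite leq_max h.
Qed.

Lemma arrive_side r Q lb u v : adj u v -> 0 < arrive r Q lb u v ->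
  exists2 s, 0 < Q s & side s u v.
Proof.
elim: r u v => [//|r IH] u v huv; rewrite [arrive _ _ _]iterS relax_pos.
case/sup_in_pos => [hq|[w [h1 h2 h3]]]; first by exists u => //; exact: side_self.
have [s hs hsd] := IH _ _ h1 h3; exists s => //.
by apply: side_ext hsd huv _; rewrite eq_sym.
Qed.

Lemma side_arrive r Q lb s u v : n <= r -> 0 < Q s -> side s u v ->
  0 < arrive r Q lb u v.
Proof.
move=> hr hq [c hc hl]; have := leq_trans (spath_size hc) hr.
elim: r c u v hc hl {hr} => [//|r IH] c u v hc hl hsz.
rewrite [arrive _ _ _]iterS relax_pos; case: c hc hl hsz => [|w c] hc hl hsz.
  by rewrite -hl in hq; apply: leq_trans hq (sup_in_geQ _ _ _ _).
have hwv : w != v.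
  exact: spath_neq hc.
have hwu : adj w u by rewrite sedgeC; exact: spath_adj (spath_cons hc).
by apply: leq_ltn_trans (sup_in_ge _ hwu hwv (IH c w u (spath_cons hc) hl _)).
Qed.

Lemma arriveP r Q lb u v : n <= r -> adj u v ->
  0 < arrive r Q lb u v <-> exists2 s, 0 < Q s & side s u v.
Proof.
move=> hr huv; split; first exact: arrive_side.
by case=> s; exact: side_arrive.
Qed.

Lemma eq_sup_in Q x x' u v :
  (forall w, adj w u -> w != v -> x w u = x' w u) -> sup_in Q x u v = sup_in Q x' u v.
Proof.
move=> h; apply/eqP; rewrite eqn_leq; apply/andP; split.
  apply/sup_in_le; split; first exact: sup_in_geQ.
  by move=> w h1 h2; rewrite h // => h3; exact: sup_in_ge.
apply/sup_in_le; split; first exact: sup_in_geQ.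
by move=> w h1 h2; rewrite -h // => h3; exact: sup_in_ge.
Qed.

(** A change of bounds acts on a time only from behind, along a simple path. This is what shows
    later that the bounds on an edge do not influence the flow into that edge. *)
Lemma arrive_diff r Q lb lb' u v : adj u v -> arrive r Q lb u v != arrive r Q lb' u v ->
  exists c c1 p q c2, [/\ spath (v :: u :: c), v :: u :: c = c1 ++ p :: q :: c2
                         & lb q p != lb' q p].
Proof.
elim: r u v => [|r IH] u v huv; first by rewrite eqxx.
rewrite ![arrive _ _ _]iterS => hne.
case: (eqVneq (lb u v) (lb' u v)) => [elb|hlb]; last first.
  by exists [::], [::], v, u, [::]; split=> //; exact: spath_pair.
case: (pickP [pred w : 'I_n | [&& adj w u, val w != v &
    arrive r Q lb w u != arrive r Q lb' w u]]) => [w /and3P[h1 h2 h3]|hno].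
  have [c [c1 [p [q [c2 [hc ec hpq]]]]]] := IH _ _ h1 h3.
  exists (val w :: c), (v :: c1), p, q, c2; split=> //; last by rewrite ec.
  by apply: spath_ext; rewrite // 1?sedgeC // eq_sym.
case/negP: hne; apply/eqP; rewrite /relax elb.
rewrite (@eq_sup_in Q _ (arrive r Q lb')) // => w h1 h2.
have /and3P[hwn _ _] := adj_wf h1.
by have := hno (Ordinal hwn); rewrite /= h1 h2 /= => /negbFE/eqP.
Qed.

(** A value that still changes after [r] rounds has a predecessor that changed one round earlier.
    Tracing this back gives a simple path with [r + 2] vertices, so [n] rounds reach a fixed
    point. *)
Lemma arrive_stable r Q lb u v : adj u v -> arrive r.+1 Q lb u v != arrive r Q lb u v ->
  exists2 c, spath (v :: u :: c) & size c = r.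
Proof.
elim: r u v => [|r IH] u v huv hne.
  by exists [::] => //; exact: spath_pair.
case: (pickP [pred w : 'I_n | [&& adj w u, val w != v &
    arrive r.+1 Q lb w u != arrive r Q lb w u]]) => [w /and3P[h1 h2 h3]|hno].
  have [c hc hsz] := IH _ _ h1 h3.
  exists (val w :: c); last by rewrite /= hsz.
  by apply: spath_ext; rewrite // 1?sedgeC // eq_sym.
case/negP: hne; apply/eqP; rewrite ![arrive _.+1 _ _]iterS /relax.
rewrite -![iter _ _ _]/(arrive _ _ _).
rewrite (@eq_sup_in Q (arrive r.+1 Q lb) (arrive r Q lb)) // => w h1 h2.
have /and3P[hwn _ _] := adj_wf h1.
by have := hno (Ordinal hwn); rewrite /= h1 h2 /= => /negbFE/eqP.
Qed.

Lemma arrive_fix r Q lb u v : n <= r -> adj u v ->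
  arrive r Q lb u v = relax Q lb (arrive r Q lb) u v.
Proof.
move=> hr huv; case: (eqVneq (arrive r.+1 Q lb u v) (arrive r Q lb u v)) => [<- //|hne].
have [c /spath_size hc hsz] := arrive_stable huv hne; lia.
Qed.

(** Minimality of the computed times: by induction on the rounds they stay below every [y] that
    meets the bounds and increases along used directions. *)
Lemma arrive_le r Q lb y :
  (forall s u v, 0 < Q s -> side s u v -> lb u v <= y u v /\ Q u <= y u v) ->
  (forall s u v w, 0 < Q s -> side s w u -> adj u v -> w != v -> y w u < y u v) ->
  forall u v, adj u v -> 0 < arrive r Q lb u v -> arrive r Q lb u v <= y u v.
Proof.
move=> h1 h2; elim: r => [//|r IH] u v huv hpos.
have [s hs hsd] := arrive_side huv hpos.
have [l1 l2] := h1 _ _ _ hs hsd.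
rewrite [arrive _ _ _]iterS /relax; case: eqP => // _; rewrite geq_max l1 andbT.
apply/sup_in_le; split=> // w hw hwv hx.
have [s' hs' hsd'] := arrive_side hw hx.
exact: leq_ltn_trans (IH _ _ hw hx) (h2 _ _ _ _ hs' hsd' huv hwv).
Qed.

(** * Temporal paths across an edge of the tree *)

Section TimePaths.

Variables (F : seq tedge) (S : seq nat).
Hypothesis (adjF : forall u w t, has_tedge F u w t -> adj u w).

(** A temporal path may pass [v] and come back to it. If its last step enters [v] from some [z]
    other than [u], then it crossed from [v] to [z] before, hence was at [v] strictly earlier;
    strong induction on the arrival time applies to that earlier visit. *)
Lemma tpath_side l s u v : tpath F s v l -> side s u v ->
  exists a l', [/\ tpath F s u a, has_tedge F u v l', a < l' & l' <= l].
Proof.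
elim/ltn_ind: l s u v => l IH s u v h hs.
have hne := side_neq hs.
inversion h as [hv hl|z w a l' hz hzv hal hw hl]; subst.
  by rewrite eqxx in hne.
case: (eqVneq z u) => [<-|hzu]; first by exists a, l; rewrite leqnn.
have hvz : adj v z by rewrite sedgeC; exact: adjF hzv.
have [a' [l' [h1 h2 h3 h4]]] := IH a hal s v z hz (side_ext hs hvz hzu).
have hl : a' < l := ltn_trans (leq_trans h3 h4) hal.
have [a2 [l2 [g1 g2 g3 g4]]] := IH a' hl s u v h1 hs.
exists a2, l2; split => //; exact: leq_trans g4 (ltnW hl).
Qed.

Lemma tpath_decP s v : (exists a, tpath F s v a) -> exists a, Defs.decP (tpath F s v a).
Proof. by case=> a ha; exists a; apply/decPP. Qed.

Definition arrival (s v : nat) : nat :=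
  if excluded_middle_informative (exists a, tpath F s v a) is left h
  then ex_minn (tpath_decP h) else 0.

Lemma arrivalP s v : (exists a, tpath F s v a) ->
  tpath F s v (arrival s v) /\ forall a, tpath F s v a -> arrival s v <= a.
Proof.
move=> h; rewrite /arrival; case: excluded_middle_informative => // h'.
case: ex_minnP => m /decPP hm hmin; split=> // a ha; apply: hmin; exact/decPP.
Qed.

Hypothesis (solF : forall s, s \in S -> forall w, w < n -> exists a, tpath F s w a).

Lemma arrival_step s u v : s \in S -> side s u v ->
  arrival s u < arrival s v /\ has_tedge F u v (arrival s v).
Proof.
move=> hs hsd; have /and3P[hu hv _] := adj_wf (side_adj hsd).
have [pu mu] := arrivalP (solF hs hu); have [pv mv] := arrivalP (solF hs hv).
have [a [l [h1 h2 h3 h4]]] := tpath_side pv hsd.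
have -> : arrival s v = l.
  by apply/eqP; rewrite eqn_leq h4 andbT; apply: mv; exact: tp_cons h1 h2 h3.
by split=> //; apply: leq_ltn_trans (mu _ h1) h3.
Qed.

(** The quantity x(u -> v) of the overview. *)
Definition latest (u v : nat) : nat :=
  \max_(s <- S | Defs.decP (side s u v)) arrival s v.

Definition used (u v : nat) : Prop := exists2 s, s \in S & side s u v.

Lemma used_ext u v w : used w u -> adj u v -> w != v -> used u v.
Proof.
case=> s hs h huv hwv; exists s => //.
by apply: side_ext h huv _; rewrite eq_sym.
Qed.

Lemma latest_ex u v : used u v ->
  exists s, [/\ s \in S, side s u v & latest u v = arrival s v].
Proof.
case=> s0 hs0 h0; rewrite /latest.
have : has (fun s => Defs.decP (side s u v)) S by apply/hasP; exists s0 => //; exact/decPP.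
elim: S => //= s r IH; rewrite big_cons; case: decPP => hsd /=; last first.
  by move/IH => [s' [h1 h2 h3]]; exists s'; rewrite inE h1 orbT.
move=> _; case: (boolP (has (fun s => Defs.decP (side s u v)) r)) => [/IH|hno].
  case=> s' [h1 h2 ->]; rewrite /maxn; case: ltnP => _.
    by exists s'; rewrite inE h1 orbT.
  by exists s; rewrite inE eqxx.
by exists s; rewrite inE eqxx big_hasC // maxn0.
Qed.

Lemma latest_ge s u v : s \in S -> side s u v -> arrival s v <= latest u v.
Proof. by move=> hs h; apply: leq_bigmax_seq => //; exact/decPP. Qed.

Lemma latest_label u v : used u v -> has_tedge F u v (latest u v).
Proof. by case/latest_ex => s [hs h ->]; case: (arrival_step hs h). Qed.

Lemma latest_pos u v : used u v -> 0 < latest u v.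
Proof.
case/latest_ex => s [hs h ->]; have [h1 _] := arrival_step hs h.
exact: leq_ltn_trans h1.
Qed.

(** The source that is last to arrive at [u] from [w] still has to go on to [v]. *)
Lemma latest_mono u v w : used w u -> adj u v -> w != v -> latest w u < latest u v.
Proof.
case/latest_ex => s [hs h ->] huv hwv.
have hsd : side s u v by apply: side_ext h huv _; rewrite eq_sym.
have [h1 _] := arrival_step hs hsd; exact: leq_trans h1 (latest_ge hs hsd).
Qed.

End TimePaths.

(** * The center of a solution *)

Definition away (a b u v : nat) : Prop := side a u v \/ side b u v.

Definition is_center (a b u v : nat) : bool :=
  ((u == a) && (v == b)) || ((u == b) && (v == a)).

Section Center.

Variables (S : seq nat) (y : nat -> nat -> nat).
Local Notation used := (used S).
Hypothesis y_mono : forall u v w, used w u -> adj u v -> w != v -> y w u < y u v.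

(** One edge further out, with [p] the vertex before [w], monotonicity and the induction hypothesis
    chain up to [y z w < y w p < y p w < y w z]. Hence only the edges at the center have to be
    checked. *)
Lemma center_spread a b :
  (forall w z, adj w z -> (w == a) || (w == b) -> ~~ is_center a b w z ->
     used w z /\ (used z w -> y z w < y w z)) ->
  forall w z, away a b w z -> ~~ is_center a b w z ->
     used w z /\ (used z w -> y z w < y w z).
Proof.
move=> hbase w z haw hc.
have [c hsp hl] : exists2 c, spath [:: z, w & c] & (last w c == a) || (last w c == b).
  by case: haw => -[c h1 h2]; exists c; rewrite // h2 eqxx ?orbT.
elim: c w z hsp hl hc {haw} => [|p c IH] w z hsp hl hc.
  by apply: hbase => //; rewrite sedgeC; exact: spath_adj hsp.
have hwz : adj w z by rewrite sedgeC; exact: spath_adj hsp.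
have hpz := spath_neq hsp.
have hwp : adj w p := spath_adj (spath_cons hsp).
case: (boolP (is_center a b p w)) => hcp.
  apply: hbase => //; case/orP: hcp => /andP[_ ->]; by rewrite ?orbT.
have [u1 u2] := IH p w (spath_cons hsp) hl hcp.
split; first exact: used_ext u1 hwz hpz.
move=> u3; have hzp : z != p by rewrite eq_sym.
have u4 := used_ext u3 hwp hzp.
apply: ltn_trans (y_mono u3 hwp hzp) _; apply: ltn_trans (u2 u4) _.
exact: y_mono.
Qed.

(** An edge with equal times in both directions is a center. Otherwise take, among the later
    directions of all edges used both ways, one with the least time; its starting vertex is a
    center, because a later direction pointing into that vertex would be earlier still. *)
Lemma center_exists : exists a b,
  [/\ a < n, a = b \/ adj a b,
      forall w z, used w z -> used z w -> away a b w z -> ~~ is_center a b w z ->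
        y z w < y w z &
      used a b -> used b a -> y a b = y b a].
Proof.
have [n0 _] := treeE.
case: (excluded_middle_informative
  (exists u v, [/\ used u v, used v u & y u v = y v u])) => [[a [b [h1 h2 h3]]]|hne].
  have hab : adj a b by case: h1 => s _ /side_adj.
  have /and3P[ha _ _] := adj_wf hab.
  exists a, b; split=> //; first by right.
  move=> w z _ hzw haw hc.
  have [//|_] := @center_spread a b _ w z haw hc; last exact.
  move=> {w z haw hc hzw}w z hwz /orP[] /eqP ew hc; subst w.
    have hbz : b != z by move: hc; rewrite /is_center eqxx negb_or eq_sym => /andP[].
    split; first exact: used_ext h2 hwz hbz.
    (* The chain is [y z a < y a b = y b a < y a z]. *)
    move=> u3; apply: ltn_trans (y_mono h2 hwz hbz); rewrite -h3.
    by apply: y_mono; rewrite // eq_sym.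
  have haz : a != z.
    by move: hc; rewrite /is_center eqxx negb_or eq_sym => /andP[_]; rewrite eq_sym.
  split; first exact: used_ext h1 hwz haz.
  move=> u3; apply: ltn_trans (y_mono h1 hwz haz); rewrite h3.
  by apply: y_mono; rewrite 1?sedgeC // eq_sym.
pose P k := exists u v, [/\ used u v, used v u, y v u < y u v & y u v = k].
case: (excluded_middle_informative (exists k, P k)) => [[k0 hk0]|hno]; last first.
  (* No edge is used in both directions, so any vertex is a center; vertex 0 exists because the tree
     is nonempty. *)
  exists 0, 0; split=> // [|w z h1 h2 _ _]; first by left.
  have hwz : y w z <> y z w by move=> e; apply: hne; exists w, z.
  case: (ltngtP (y w z) (y z w)) => // h; case: hno.
  by exists (y z w), z, w.
have hex : exists k, Defs.decP (P k) by exists k0; apply/decPP.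
case: (ex_minnP hex) => k /decPP[a [v [h1 h2 h3 h4]]] hmin.
have hav : adj a v by case: h1 => s _ /side_adj.
have /and3P[ha _ _] := adj_wf hav.
have notc w z : adj w z -> ~~ is_center a a w z.
  case/adj_wf/and3P=> _ _; apply: contraNN; rewrite /is_center orbb.
  by case/andP=> /eqP-> /eqP->.
exists a, a; split=> //; first by left.
move=> w z _ hzw haw hc.
have [//|_] := @center_spread a a _ w z haw hc; last exact.
move=> {w z haw hc hzw}w z hwz; rewrite orbb => /eqP ew _; subst w.
case: (eqVneq v z) => [<- //|hvz].
split; first exact: used_ext h2 hwz hvz.
move=> u3; have hzv : z != v by rewrite eq_sym.
have h5 := y_mono u3 hav hzv.
case: (ltngtP (y a z) (y z a)) => // h6; last first.
  by case: hne; exists a, z; split=> //; exact: used_ext h2 hwz hvz.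
(* The direction from [z] to [a] would be a later direction with time below the minimum [k]. *)
have hbad := hmin (y z a); rewrite -h4 leqNgt h5 in hbad.
suff : false by []; apply: hbad.
apply/decPP; exists z, a; split=> //; exact: used_ext h2 hwz hvz.
Qed.

End Center.

Lemma maxo_leo x z K : leo (maxo x z) (Some K) = leo x (Some K) && leo z (Some K).
Proof. by case: x z => [x|] [z|] //=; rewrite ?geq_max // andbF. Qed.

Lemma value_le F S K : leo (value n S F) (Some K) <->
  forall s, s \in S -> reaches_all_by n F s K.
Proof.
have hrt s : leo (reachtime n F s) (Some K) <-> reaches_all_by n F s K.
  rewrite /reachtime; case: excluded_middle_informative => h /=; last first.
    by split=> // h'; case: h; exists K.
  case: ex_minnP => m /decPP hm hmin; split=> [hle w hw|hK].
    by have [a [h1 h2]] := hm w hw; exists a; split=> //; exact: leq_trans hle.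
  by apply: hmin; apply/decPP.
rewrite /value; elim: S => [|s S IH]; first by split.
rewrite [foldr _ _ _]/= maxo_leo; split.
  case/andP => /hrt h1 /IH h2 x; rewrite inE => /orP[/eqP->//|]; exact: h2.
move=> h; apply/andP; split; first by apply/hrt; apply: h; rewrite inE eqxx.
by apply/IH => x hx; apply: h; rewrite inE hx orbT.
Qed.

(** * The candidate solution of a given center *)

Section Candidate.

Variables (S : seq nat) (N : nat) (t1 t2 : nat -> nat -> nat).
Hypotheses (sizeS : all (fun s => s < n) S) (hN : n <= N).
Hypothesis lowest : forall u v, adj u v ->
  [/\ has_tedge E u v (t1 u v),
      forall t, has_tedge E u v t -> t1 u v <= t,
      forall t, has_tedge E u v t -> t != t1 u v -> 0 < t2 u v <= t &
      0 < t2 u v -> has_tedge E u v (t2 u v) /\ t2 u v != t1 u v].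

Definition sources (s : nat) : nat := s \in S.
Definition ends (a b s : nat) : nat := (s == a) || (s == b).
Definition free : nat -> nat -> nat := fun _ _ => 0.

Definition usedb (u v : nat) : bool := 0 < arrive N sources free u v.
Definition awayb (a b u v : nat) : bool := 0 < arrive N (ends a b) free u v.

(** A center edge leads away in both directions and so is never lifted. An edge with a single label
    is not lifted either; if it is used both ways, it has to pass the equality test of
    [accepted]. *)
Definition lifted (a b u v : nat) : bool :=
  [&& usedb u v, usedb v u, awayb a b u v, ~~ awayb a b v u & 0 < t2 u v].

Definition bound1 (a b u v : nat) : nat := if lifted a b u v then t2 u v else t1 u v.
Definition early (a b : nat) : nat -> nat -> nat := arrive N sources (bound1 a b).
(* Both directions of a center edge have to share one label, so they are bounded
   by the later of the two times that a first run gives for them. *)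
Definition bound2 (a b u v : nat) : nat :=
  maxn (bound1 a b u v)
       (if is_center a b u v then maxn (early a b u v) (early a b v u) else 0).
Definition late (a b : nat) : nat -> nat -> nat := arrive N sources (bound2 a b).

Definition accepted (a b : nat) : Prop := forall u v, adj u v ->
  usedb u v -> usedb v u -> [|| lifted a b u v, lifted a b v u | late a b u v == late a b v u].

(** The lifted direction gets all labels but the smallest, any other direction the smallest one. Two
    directions compete for a label only if neither is lifted, and then [accepted] makes their times
    equal. *)
Definition contrib (a b u v t : nat) : nat :=
  if (if lifted a b u v then t != t1 u v else t == t1 u v) then late a b u v else 0.
Definition new_label (a b u v t : nat) : nat :=
  maxn t (maxn (contrib a b u v t) (contrib a b v u t)).
Definition delayed (a b : nat) : seq tedge :=
  [seq (x.1.1, x.1.2, new_label a b x.1.1 x.1.2 x.2) | x <- E].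

(** The maximum is characterised by its upper bounds, so that the program may compute it over edge
    indices. *)
Definition score (a b V : nat) : Prop :=
  forall W, V <= W <-> forall u v, adj u v -> late a b u v <= W.

Lemma new_labelC a b u v t : new_label a b u v t = new_label a b v u t.
Proof. by rewrite /new_label [maxn (contrib _ _ _ _ _) _]maxnC. Qed.

Lemma has_tedge_delayed a b u v t' : has_tedge (delayed a b) u v t' <->
  exists2 t, has_tedge E u v t & t' = new_label a b u v t.
Proof.
split.
  by case/orP => /mapP[[[x z] t] hx [-> -> ->]] /=; exists t;
    rewrite /has_tedge ?hx ?orbT // new_labelC.
case=> t /orP[] h ->; apply/orP; [left|right]; apply/mapP.
  by exists (u, v, t).
by exists (v, u, t); rewrite // new_labelC.
Qed.

Lemma delayed_is_delay a b : is_delay E (delayed a b).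
Proof.
exists (fun u w t => new_label a b u w t - t); split=> [u w t|u w t'].
  by rewrite new_labelC.
have e t : t + (new_label a b u w t - t) = new_label a b u w t.
  by rewrite subnKC // /new_label leq_maxl.
split; first by case/has_tedge_delayed => t h ->; exists t; rewrite e.
by case=> t [h ->]; apply/has_tedge_delayed; exists t; rewrite ?e.
Qed.

Lemma t1C u v : adj u v -> t1 u v = t1 v u.
Proof.
move=> huv; have hvu : adj v u by rewrite sedgeC.
have [h1 h2 _ _] := lowest huv; have [g1 g2 _ _] := lowest hvu.
by apply/eqP; rewrite eqn_leq h2 1?has_tedgeC // g2 // has_tedgeC.
Qed.

Lemma usedbP u v : adj u v -> reflect (used S u v) (usedb u v).
Proof.
move=> huv; apply: (iffP idP); rewrite /usedb.
  by case/(arriveP sources free hN huv) => s hs h; exists s => //; move: hs; rewrite /sources lt0b.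
by case=> s hs h; apply/(arriveP sources free hN huv); exists s; rewrite // /sources lt0b.
Qed.

Lemma awaybP a b u v : adj u v -> reflect (away a b u v) (awayb a b u v).
Proof.
move=> huv; apply: (iffP idP); rewrite /awayb.
  case/(arriveP (ends a b) free hN huv) => s; rewrite /ends lt0b.
  by case/orP => /eqP->; [left|right].
move=> h; apply/(arriveP (ends a b) free hN huv).
by case: h => h; [exists a|exists b]; rewrite // /ends eqxx ?orbT.
Qed.

Lemma late_usedb a b u v : adj u v -> (0 < late a b u v) = usedb u v.
Proof.
move=> huv; rewrite /late /usedb.
by apply/idP/idP => /(arriveP _ _ hN huv) h; apply/(arriveP _ _ hN huv).
Qed.

Lemma late_ge a b u v : adj u v -> 0 < late a b u v ->
  bound1 a b u v <= late a b u v.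
Proof.
move=> huv; rewrite /late (arrive_fix _ _ hN huv) relax_pos /relax => h.
rewrite eqn0Ngt h /= leq_max; apply/orP; right; exact: leq_maxl.
Qed.

Lemma late_label a b u v : accepted a b -> adj u v -> 0 < late a b u v ->
  has_tedge (delayed a b) u v (late a b u v).
Proof.
move=> hacc huv hpos; have hvu : adj v u by rewrite sedgeC.
have huse : usedb u v by rewrite -(late_usedb a b).
have hge := late_ge huv hpos; have [l1 l2 l3 l4] := lowest huv.
apply/has_tedge_delayed; case: (boolP (lifted a b u v)) => hl.
  have /and5P[_ _ _ hnot h0] := hl; have [g1 g2] := l4 h0.
  exists (t2 u v) => //.
  have hl' : lifted a b v u = false.
    by rewrite /lifted (negbTE hnot) !andbF.
  rewrite /bound1 hl in hge.
  by rewrite /new_label /contrib hl hl' g2 -(t1C huv) (negbTE g2) maxn0 (maxn_idPr hge).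
exists (t1 u v) => //.
rewrite /bound1 (negbTE hl) in hge.
rewrite /new_label /contrib (negbTE hl) eqxx -(t1C huv) eqxx.
case: (boolP (lifted a b v u)) => hl'; first by rewrite maxn0 (maxn_idPr hge).
case: (posnP (late a b v u)) => [->|hpos']; first by rewrite maxn0 (maxn_idPr hge).
rewrite (late_usedb a b hvu) in hpos'.
have := hacc u v huv huse hpos'; rewrite (negbTE hl) (negbTE hl') /= => /eqP <-.
by rewrite maxnn (maxn_idPr hge).
Qed.

Lemma accepted_tpath a b s u c v : accepted a b -> s \in S ->
  spath (v :: u :: c) -> last u c = s ->
  0 < late a b u v /\ exists2 l, tpath (delayed a b) s v l & l <= late a b u v.
Proof.
move=> hacc hs.
have step u' v' : side s u' v' -> 0 < late a b u' v' /\
    has_tedge (delayed a b) u' v' (late a b u' v').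
  move=> h; have h' := side_adj h.
  have hpos : 0 < late a b u' v' by rewrite late_usedb //; apply/usedbP => //; exists s.
  by split=> //; exact: late_label.
elim: c u v => [|w c IH] u v hc hl.
  have [|hpos hlab] := step u v; first by exists [::].
  split=> //; exists (late a b u v) => //.
  by rewrite /= in hl; rewrite hl in hlab hpos *; apply: tp_cons hlab hpos; exact: tp_nil.
have [|hpos hlab] := step u v; first by exists (w :: c).
split=> //; exists (late a b u v) => //.
have huv : adj u v by rewrite sedgeC; exact: spath_adj hc.
have [h1 [l h2 h3]] := IH w u (spath_cons hc) hl.
apply: tp_cons h2 hlab _; apply: leq_ltn_trans h3 _.
have hwu : adj w u by rewrite sedgeC; exact: spath_adj (spath_cons hc).
rewrite [X in _ < X](arrive_fix _ _ hN huv) -/(late a b) /relax.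
have := sup_in_ge sources hwu (spath_neq hc) h1.
case: eqP => [->//|_] h; rewrite leq_max h //.
Qed.

(** Acceptance alone makes the delayed graph a solution, even if [a] and [b] form no center of any
    solution; the search can therefore try pairs blindly. *)
Lemma accepted_sound a b V : accepted a b -> score a b V ->
  is_solution n S E (delayed a b) /\ leo (value n S (delayed a b)) (Some V).
Proof.
move=> hacc hV.
have hreach s w : s \in S -> w < n -> exists a', a' <= V /\ tpath (delayed a b) s w a'.
  move=> hs hw; have hsn := allP sizeS _ hs.
  have [[|u c] hc hl] := spath_exists hsn hw.
    by exists 0; split=> //; rewrite -hl; exact: tp_nil.
  have [_ [l h1 h2]] := accepted_tpath hacc hs hc hl.
  exists l; split=> //; apply: leq_trans h2 _.
  by apply/(hV V).1 => //; rewrite sedgeC; exact: spath_adj hc.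
split; last by apply/value_le => s hs w hw; exact: hreach.
split; first exact: delayed_is_delay.
by move=> s hs w hw; have [a' [_ h]] := hreach s w hs hw; exists a'.
Qed.

(** The times [latest] of [F] satisfy every inequality imposed for the center of [F], so the least
    times lie below them, and this same center passes the acceptance test. *)
Lemma solution_center F : is_solution n S E F -> exists a b,
  [/\ a < n, a = b \/ adj a b, accepted a b &
      forall V, score a b V -> leo (Some V) (value n S F)].
Proof.
case=> -[d [dC hd]] hsol.
have adjF u w t : has_tedge F u w t -> adj u w.
  by case/hd => t' [h _]; apply/sedgeP; exists t'.
pose y := latest F S.
have y_mono u v w : used S w u -> adj u v -> w != v -> y w u < y u v.
  exact: latest_mono.
have y_label u v : used S u v -> has_tedge F u v (y u v) by exact: latest_label.
have y_pos u v : used S u v -> 0 < y u v by exact: latest_pos.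
have [a [b [ha hab hcen heq]]] := center_exists y_mono.
have y_t1 u v : used S u v -> t1 u v <= y u v.
  move=> hu; have huv : adj u v by case: hu => s _ /side_adj.
  have /hd[t [ht ->]] := y_label _ _ hu; have [_ h _ _] := lowest huv.
  by apply: leq_trans (h _ ht) (leq_addr _ _).
(* Equal labels of one edge get equal delays, so the two crossings come from different labels. One
   of these is not the smallest, and its delayed time is at most [y u v]. *)
have y_t2 u v : used S u v -> used S v u -> y v u < y u v -> 0 < t2 u v <= y u v.
  move=> hu hu' hlt; have huv : adj u v by case: hu => s _ /side_adj.
  have /hd[t [ht et]] := y_label _ _ hu; have /hd[t' [ht' et']] := y_label _ _ hu'.
  have [_ _ h _] := lowest huv.
  case: (eqVneq t (t1 u v)) => [e|hne]; last first.
    by have /andP[-> h2] := h _ ht hne; rewrite et; apply: leq_trans h2 (leq_addr _ _).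
  have hne : t' != t1 u v.
    by apply/eqP => e'; move: hlt; rewrite et et' e e' dC ltnn.
  rewrite has_tedgeC in ht'; have /andP[-> h2] := h _ ht' hne.
  by apply: leq_trans (ltnW hlt); rewrite et'; apply: leq_trans h2 (leq_addr _ _).
have both_away u v : adj u v -> is_center a b u v -> away a b v u.
  move=> huv; have hvu : adj v u by rewrite sedgeC.
  by case/orP => /andP[/eqP eu /eqP ev]; rewrite /away -?eu -?ev; [right|left]; exact: side_self.
have y_b1 u v : used S u v -> bound1 a b u v <= y u v.
  move=> hu; have huv : adj u v by case: hu => s _ /side_adj.
  have hvu : adj v u by rewrite sedgeC.
  rewrite /bound1; case: ifP => [|_]; last exact: y_t1.
  case/and5P => _ /(usedbP hvu) hu' /(awaybP _ _ huv) h1 /(awaybP _ _ hvu) h2 _.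
  have hc : ~~ is_center a b u v by apply/negP => /(both_away _ _ huv).
  by have /andP[] := y_t2 _ _ hu hu' (hcen _ _ hu hu' h1 hc).
have used_of s u v : 0 < sources s -> side s u v -> used S u v.
  by rewrite /sources lt0b => hs h; exists s.
have src_le u v : used S u v -> sources u <= y u v.
  by move=> /y_pos; rewrite /sources; case: (u \in S).
have early_le u v : adj u v -> 0 < early a b u v -> early a b u v <= y u v.
  apply: arrive_le => [s u' v' hs h|s u' v' w hs h]; have hu := used_of _ _ _ hs h.
    by split; [exact: y_b1|exact: src_le].
  exact: y_mono.
have center_eq u v : used S u v -> used S v u -> is_center a b u v -> y u v = y v u.
  move=> hu hu' /orP[] /andP[/eqP eu /eqP ev]; subst u v; first exact: heq.
  by apply/esym; exact: heq.
(* On a center edge [y] agrees in both directions and hence dominates both times of the first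
   run. *)
have y_b2 u v : used S u v -> bound2 a b u v <= y u v.
  move=> hu; have huv : adj u v by case: hu => s _ /side_adj.
  have hvu : adj v u by rewrite sedgeC.
  rewrite /bound2 geq_max y_b1 //=; case: ifP => // hc.
  rewrite geq_max; apply/andP; split.
    by case: (posnP (early a b u v)) => [->//|h]; exact: early_le.
  case: (posnP (early a b v u)) => [->//|h].
  have hu' : used S v u.
    by have [s hs hsd] := arrive_side hvu h; exact: used_of hs hsd.
  by rewrite (center_eq _ _ hu hu' hc); exact: early_le.
have late_le u v : adj u v -> 0 < late a b u v -> late a b u v <= y u v.
  apply: arrive_le => [s u' v' hs h|s u' v' w hs h]; have hu := used_of _ _ _ hs h.
    by split; [exact: y_b2|exact: src_le].
  exact: y_mono.
have score_le V : score a b V -> leo (Some V) (value n S F).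
  move=> hV; case e: (value n S F) => [z|] //=; apply/(hV z) => u v huv.
  case: (posnP (late a b u v)) => [->//|hpos].
  apply: leq_trans (late_le _ _ huv hpos) _.
  have hu : used S u v by apply/usedbP => //; rewrite -(late_usedb a b).
  rewrite /y; have [s [hs h ->]] := latest_ex F hu.
  have /value_le hz : leo (value n S F) (Some z) by rewrite e /=.
  have /and3P[_ hv _] := adj_wf huv.
  have [l [h1 h2]] := hz s hs v hv.
  apply: leq_trans h1; have [_] := arrivalP (hsol s hs v hv); exact.
exists a, b; split=> // u v huv hub hvb.
have hvu : adj v u by rewrite sedgeC.
have hu : used S u v by apply/usedbP.
have hu' : used S v u by apply/usedbP.
case: (boolP (is_center a b u v)) => hc; last first.
  have hc' : ~~ is_center a b v u by rewrite /is_center orbC [X in _ || X]andbC [X in X || _]andbC.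
  (* Both ends of the center lie on the same side of any edge other than the center. *)
  have excl : away a b u v -> away a b v u -> False.
    case=> h1 [] h2; first exact: side_excl h1 h2.
    - case: hab => [e|hab]; first by rewrite -e in h2; exact: side_excl h1 h2.
      case: (side_shift hab h1) => [h|[e1 e2]]; first exact: side_excl h h2.
      by case/negP: hc; rewrite /is_center e1 e2 !eqxx.
    - case: hab => [e|hab]; first by rewrite -e in h1; exact: side_excl h1 h2.
      case: (side_shift hab h2) => [h|[e1 e2]]; first exact: side_excl h1 h.
      by case/negP: hc; rewrite /is_center e1 e2 !eqxx orbT.
    - exact: side_excl h1 h2.
  have hl x z : adj x z -> used S x z -> used S z x -> away a b x z ->
      ~~ is_center a b x z -> (away a b x z -> away a b z x -> False) -> lifted a b x z.
    move=> hxz h1 h2 h3 h4 h5; have hzx : adj z x by rewrite sedgeC.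
    have /andP[hpos _] := y_t2 _ _ h1 h2 (hcen _ _ h1 h2 h3 h4).
    apply/and5P; split=> //; try exact/usedbP; first exact/awaybP.
    by apply/(awaybP _ _ hzx) => h6; exact: h5.
  case: (side_total ha huv) => h.
    by rewrite hl //; left.
  by rewrite (hl v u) ?orbT //; [left|move=> g1 g2; exact: excl g2 g1].
(* The second run changes bounds on the center edge only, and a simple path entering that edge has
   not crossed it, so the inflow is that of the first run. The resulting formula is symmetric once
   both values of [bound1] are the common smallest label. *)
have key x z : adj x z -> used S x z -> is_center a b x z ->
    late a b x z = maxn (bound1 a b x z) (maxn (early a b x z) (early a b z x)).
  move=> hxz hxu hcx.
  have hsup : sup_in sources (late a b) x z = sup_in sources (early a b) x z.
    apply: eq_sup_in => w hwx hwz; apply/eqP/negPn/negP.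
    case/(arrive_diff hwx) => c [c1 [p [q [c2 [hsp e hne]]]]].
    have hcpq : is_center a b q p.
      by apply: contraNT hne => hn; rewrite /bound2 (negbTE hn) maxn0.
    have hpq : ((p == x) && (q == z)) || ((p == z) && (q == x)).
      case/orP: hcpq hcx => /andP[/eqP-> /eqP->] /orP[] /andP[/eqP-> /eqP->];
        by rewrite !eqxx ?orbT.
    have /andP[hun _] := hsp.
    case: c1 e => [[ep [eq _]]|x' c1 [ex' e']].
      case/orP: hpq => /andP[/eqP e1 /eqP e2]; first by rewrite eq e2 eqxx in hwz.
      have := spath_adj hsp; rewrite eq e2 => hxx.
      by have /and3P[_ _] := adj_wf hxx; rewrite eqxx.
    move: hun; rewrite cons_uniq e' mem_cat !inE !negb_or => /andP[/and3P[_ h1 /andP[h2 _]] _].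
    by case/orP: hpq => /andP[/eqP e1 /eqP e2]; rewrite ?e1 ?e2 eqxx in h1 h2.
  have h1 : 0 < sup_in sources (early a b) x z.
    by rewrite -hsup -(relax_pos _ (bound2 a b)) -(arrive_fix _ _ hN hxz) late_usedb //; apply/usedbP.
  have e1 : early a b x z = maxn (sup_in sources (early a b) x z) (bound1 a b x z).
    by rewrite /early [LHS](arrive_fix _ _ hN hxz) /relax eqn0Ngt h1.
  rewrite /late [LHS](arrive_fix _ _ hN hxz) /relax -/(late a b) hsup eqn0Ngt h1 /=.
  rewrite /bound2 hcx e1; move: (sup_in _ _ _ _) (bound1 _ _ _ _) (early _ _ z x).
  clear; lia.
apply/or3P; apply: Or33; apply/eqP.
have hc' : is_center a b v u by move: hc; rewrite /is_center orbC [X in _ || X]andbC [X in X || _]andbC.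
rewrite (key _ _ huv hu hc) (key _ _ hvu hu' hc').
have eb x z : is_center a b x z -> adj x z -> bound1 a b x z = t1 x z.
  move=> hcx hxz; rewrite /bound1; case: ifP => // /and5P[_ _ _ h _].
  by case/negP: h; apply/awaybP; rewrite 1?sedgeC //; exact: both_away.
by rewrite !eb // (t1C huv) [maxn (early _ _ _ _) _]maxnC.
Qed.

End Candidate.

End Tree.

(** * The algorithm *)

(** Conditions count as true when nonzero. The two truncated differences vanish together exactly at
    equality. *)
Definition eNe (a b : expr) : expr := EAdd (ESub a b) (ESub b a).
Definition eNot (a : expr) : expr := EIf a (EC 0) (EC 1).
Definition eAnd (a b : expr) : expr := EIf a b (EC 0).
Definition eOr (a b : expr) : expr := EIf a (EC 1) b.
Definition eEq (a b : expr) : expr := eNot (eNe a b).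
Definition eMx (a b : expr) : expr := EAdd a (ESub b a).

Section EvalMacros.
Variables (N : nat) (env : nat -> nat) (st : store).
Local Notation ev := (eval N env st).

Lemma ev_Ne a b : (ev (eNe a b) == 0) = (ev a == ev b).
Proof. by rewrite /=; lia. Qed.
Lemma ev_Not a : (ev (eNot a) == 0) = (ev a != 0).
Proof. by rewrite /=; case: (ev a == 0). Qed.
Lemma ev_And a b : (ev (eAnd a b) == 0) = (ev a == 0) || (ev b == 0).
Proof. by rewrite /=; case: (ev a == 0). Qed.
Lemma ev_Or a b : (ev (eOr a b) == 0) = (ev a == 0) && (ev b == 0).
Proof. by rewrite /=; case: (ev a == 0). Qed.
Lemma ev_Eq a b : (ev (eEq a b) == 0) = (ev a != ev b).
Proof. by rewrite ev_Not ev_Ne. Qed.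
Lemma ev_Mx a b : ev (eMx a b) = maxn (ev a) (ev b).
Proof. by rewrite /= maxnE. Qed.
Lemma ev_If a b c : ev (EIf a b c) = if ev a == 0 then ev c else ev b.
Proof. by []. Qed.
Lemma ev_Sub a b : (ev (ESub a b) == 0) = (ev a <= ev b).
Proof. by rewrite /= subn_eq0. Qed.
Lemma ev_R a e : ev (ER a e) = st a (ev e).
Proof. by []. Qed.
Lemma ev_Max x e : ev (EMax x e) = \max_(i < N) eval N (upd env x i) st e.
Proof. by []. Qed.
Lemma ev_C c : ev (EC c) = c.
Proof. by []. Qed.
Lemma ev_V x : ev (EV x) = env x.
Proof. by []. Qed.
Lemma ev_Add a b : ev (EAdd a b) = ev a + ev b.
Proof. by []. Qed.
Lemma ev_SubE a b : ev (ESub a b) = ev a - ev b.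
Proof. by []. Qed.
End EvalMacros.

Definition evE := (ev_Ne, ev_Not, ev_And, ev_Or, ev_Eq, ev_Mx, ev_If, ev_Sub, ev_R,
  ev_Max, ev_C, ev_V, ev_Add, ev_SubE).

Arguments eNe : simpl never.
Arguments eNot : simpl never.
Arguments eAnd : simpl never.
Arguments eOr : simpl never.
Arguments eEq : simpl never.
Arguments eMx : simpl never.

(** Round [k] still sees the old contents of [a] from cell [k] on, so [e] may read the very cell
    that it replaces. *)
Lemma fill N env st d a e (f : nat -> nat) :
  (forall k st', k < N -> (forall b j, (b != a) || (k <= j) -> st' b j = st b j) ->
     eval N (upd env d k) st' e = f k) ->
  let st' := sem N env (CFor d (CSet a (EV d) e)) st in
  (forall k, k < N -> st' a k = f k) /\
  (forall b j, (b != a) || (N <= j) -> st' b j = st b j).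
Proof.
move=> h; rewrite [sem _ _ _ _]/=.
suff H i : i <= N -> let st' := iteri i
      (fun i st => upd2 st a (upd env d i d) (eval N (upd env d i) st e)) st in
    (forall k, k < i -> st' a k = f k) /\
    (forall b j, (b != a) || (i <= j) -> st' b j = st b j).
  exact: H (leqnn N).
elim: i => [|i IH] hi; first by split.
have [h1 h2] := IH (ltnW hi); rewrite [iteri _ _ _]/= upd_eq /upd2.
split=> [k hk|b j hbj].
  rewrite eqxx /=; case: eqP => [->|hne]; last by apply: h1; lia.
  by rewrite (h i) // => b j /h2.
have -> : (b == a) && (j == i) = false by lia.
by apply: h2; lia.
Qed.

(* Arrays: 0 input and output; 1, 2, 3 tails, heads and labels of the directed
   edges; 4, 5 their two smallest labels (0 if there is no second one); 6 sources;
   7 ends of the center; 8 lower bounds; 9 arrival times; 10 scratch; 11, 12, 13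
   directions used, leading away from the center, and bounded by the second
   smallest label; 14 labels of the best solution so far.  The cells of 15 are
   scalars; cell 1 holds the best value plus one, or 0 as long as no center has
   been accepted. *)
Definition eM : expr := ER 0 (EC 1).
Definition e2M : expr := EAdd eM eM.
Definition eTriple (k : expr) (o : nat) : expr := ER 0 (EAdd (EC o) (EAdd k (EAdd k k))).
Definition eU (k : expr) : expr := ER 1 k.
Definition eV (k : expr) : expr := ER 2 k.
Definition eT (k : expr) : expr := ER 3 k.
Definition eT1 (k : expr) : expr := ER 4 k.
Definition eT2 (k : expr) : expr := ER 5 k.
Definition eX (k : expr) : expr := ER 9 k.
Definition eUsed (k : expr) : expr := ER 11 k.
Definition eAway (k : expr) : expr := ER 12 k.
Definition eLift (k : expr) : expr := ER 13 k.
Definition eRev (k : expr) : expr := EIf (ESub eM k) (EAdd k eM) (ESub k eM).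
Definition eBad : expr := ER 15 (EC 0).
Definition eBest : expr := ER 15 (EC 1).
Definition eBetter : expr := ER 15 (EC 2).
Definition eVal : expr := ER 15 (EC 4).
Definition eBig : expr := ER 15 (EC 5).
Definition eA : expr := ER 15 (EC 6).
Definition eB : expr := ER 15 (EC 7).

(** Field [o] of the triples fills the first half and field [o'] the reversed copies, so that
    exchanging 2 and 3 turns tails into heads; [dflt] goes to the indices beyond. *)
Definition cEdge (a o o' : nat) (dflt : expr) : cmd :=
  CFor 0 (CSet a (EV 0)
    (EIf (ESub eM (EV 0)) (eTriple (EV 0) o)
       (EIf (ESub e2M (EV 0)) (eTriple (ESub (EV 0) eM) o') dflt))).

Definition eSame : expr :=
  eAnd (eEq (eU (EV 1)) (eU (EV 0))) (eEq (eV (EV 1)) (eV (EV 0))).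
(** Only maxima are primitive, so the least label is found as the greatest distance below [eBig]. As
    [eBig] exceeds all labels, 0 means that no label qualifies. *)
Definition eMinGap (c : expr) : expr :=
  EMax 1 (EIf c (ESub eBig (eT (EV 1))) (EC 0)).
Definition eGap2 : expr := eMinGap (eAnd eSame (eNe (eT (EV 1)) (eT1 (EV 0)))).

Fixpoint cSeq (cs : seq cmd) : cmd :=
  match cs with
  | [::] => CSet 15 (EC 3) (EC 0)
  | [:: c] => c
  | c :: cs => CSeq c (cSeq cs)
  end.

Definition setup : cmd := cSeq
  [:: cEdge 1 2 3 (ER 0 (EC 0)); cEdge 2 3 2 (ER 0 (EC 0)); cEdge 3 4 4 (EC 0);
      CSet 15 (EC 5) (EAdd (EMax 0 (eT (EV 0))) (EC 1));
      CFor 0 (CSet 4 (EV 0) (ESub eBig (eMinGap eSame)));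
      CFor 0 (CSet 5 (EV 0) (EIf eGap2 (ESub eBig eGap2) (EC 0)));
      CFor 0 (CSet 6 (EV 0) (EMax 1
        (EIf (eAnd (ESub (eTriple eM 2) (EV 1))
                   (eEq (ER 0 (EAdd (EAdd (EC 3) (EV 1)) (EAdd eM (EAdd eM eM)))) (EV 0)))
           (EC 1) (EC 0))));
      CSet 15 (EC 1) (EC 0)].

Definition eSup (q : nat) : expr :=
  eMx (ER q (eU (EV 2)))
    (EMax 3 (EIf (eAnd (eEq (eV (EV 3)) (eU (EV 2)))
                    (eAnd (eNe (eU (EV 3)) (eV (EV 2))) (eX (EV 3))))
               (EAdd (eX (EV 3)) (EC 1)) (EC 0))).

(** Array 10 collects the suprema of a round before array 9 changes, so that all directions are
    updated simultaneously, as in [arrive]. *)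
Definition iterate (q : nat) (lb : expr) : cmd :=
  CSeq (CFor 1 (CSet 9 (EV 1) (EC 0)))
   (CFor 1 (CSeq (CFor 2 (CSet 10 (EV 2) (eSup q)))
                 (CFor 2 (CSet 9 (EV 2)
                    (EIf (ER 10 (EV 2)) (eMx (ER 10 (EV 2)) lb) (EC 0)))))).

Definition eCenter : expr :=
  eOr (eAnd (eEq (eU (EV 1)) eA) (eEq (eV (EV 1)) eB))
      (eAnd (eEq (eU (EV 1)) eB) (eEq (eV (EV 1)) eA)).

Definition eContrib (k : expr) : expr :=
  EIf (EIf (eLift k) (eNe (eT (EV 1)) (eT1 k)) (eEq (eT (EV 1)) (eT1 k)))
    (eX k) (EC 0).

Definition set_center : cmd := cSeq
  [:: CSet 15 (EC 6) (EIf (ESub e2M (EV 0)) (eU (EV 0)) (ESub (EV 0) e2M));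
      CSet 15 (EC 7) (EIf (ESub e2M (EV 0)) (eV (EV 0)) (ESub (EV 0) e2M));
      CFor 1 (CSet 7 (EV 1) (EIf (eOr (eEq (EV 1) eA) (eEq (EV 1) eB)) (EC 1) (EC 0)))].

Definition flags : cmd := cSeq
  [:: iterate 6 (EC 0);
      CFor 1 (CSet 11 (EV 1) (eX (EV 1)));
      iterate 7 (EC 0);
      CFor 1 (CSet 12 (EV 1) (eX (EV 1)));
      CFor 1 (CSet 13 (EV 1)
        (EIf (eAnd (eUsed (EV 1)) (eAnd (eUsed (eRev (EV 1)))
               (eAnd (eAway (EV 1)) (eAnd (eNot (eAway (eRev (EV 1)))) (eT2 (EV 1))))))
           (EC 1) (EC 0)))].

Definition times : cmd := cSeq
  [:: CFor 1 (CSet 8 (EV 1) (EIf (eLift (EV 1)) (eT2 (EV 1)) (eT1 (EV 1))));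
      iterate 6 (ER 8 (EV 2));
      CFor 1 (CSet 8 (EV 1) (eMx (ER 8 (EV 1))
        (EIf eCenter (eMx (eX (EV 1)) (eX (eRev (EV 1)))) (EC 0))));
      iterate 6 (ER 8 (EV 2))].

Definition decide : cmd := cSeq
  [:: CSet 15 (EC 0) (EMax 1
        (EIf (eAnd (eUsed (EV 1)) (eAnd (eUsed (eRev (EV 1)))
               (eAnd (eNot (eLift (EV 1))) (eAnd (eNot (eLift (eRev (EV 1))))
                  (eNe (eX (EV 1)) (eX (eRev (EV 1))))))))
           (EC 1) (EC 0)));
      CSet 15 (EC 4) (EMax 1 (eX (EV 1)));
      CSet 15 (EC 2) (eAnd (eNot eBad) (EIf eBest (ESub eBest (EAdd eVal (EC 1))) (EC 1)));
      CFor 1 (CSet 14 (EV 1) (EIf eBetter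
        (eMx (eT (EV 1)) (eMx (eContrib (EV 1)) (eContrib (eRev (EV 1)))))
        (ER 14 (EV 1))));
      CSet 15 (EC 1) (EIf eBetter (EAdd eVal (EC 1)) eBest)].

Definition candidate : cmd := CSeq set_center (CSeq flags (CSeq times decide)).

(** From cell 2 on the output has the layout of the input, so only labels are overwritten. Cell 1 is
    set last because until then it holds the number of time-edges. *)
Definition report : cmd := cSeq
  [:: CFor 0 (CSet 0 (EAdd (EC 4) (EAdd (EV 0) (EAdd (EV 0) (EV 0)))) (ER 14 (EV 0)));
      CSet 0 (EC 0) (EIf eBest (EAdd (EC 1) (EAdd eM (EAdd eM eM))) (EC 1));
      CSet 0 (EC 1) (EIf eBest (EC 1) (EC 0))].

Definition solver : cmd := CSeq setup (CSeq (CFor 0 candidate) report).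

Lemma solver_wf : wfc 0 solver.
Proof. by vm_compute. Qed.

(** * Correctness of the algorithm *)

Lemma nth_enc_edges (E : seq tedge) k : k < size E ->
  [/\ nth 0 (enc_edges E) (k + (k + k)) = (nth (0, 0, 0) E k).1.1,
      nth 0 (enc_edges E) (k + (k + k)).+1 = (nth (0, 0, 0) E k).1.2 &
      nth 0 (enc_edges E) (k + (k + k)).+2 = (nth (0, 0, 0) E k).2].
Proof.
elim: E k => [//|[[u w] t] E IH] [_|k hk]; first by [].
have -> : k.+1 + (k.+1 + k.+1) = (k + (k + k)).+3 by lia.
exact: IH.
Qed.

Lemma size_enc_edges (E : seq tedge) : size (enc_edges E) = size E + (size E + size E).
Proof. by elim: E => [//|[[u w] t] E IH] /=; rewrite [size _]IH; lia. Qed.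

Lemma sem_cons N env c c' cs st :
  sem N env (cSeq [:: c, c' & cs]) st = sem N env (cSeq (c' :: cs)) (sem N env c st).
Proof. by []. Qed.

Lemma sem_seq N env c c' st : sem N env (CSeq c c') st = sem N env c' (sem N env c st).
Proof. by []. Qed.

Lemma sem_for N env x c st :
  sem N env (CFor x c) st = iteri N (fun i => sem N (upd env x i) c) st.
Proof. by []. Qed.

Lemma sem_set N env a e1 e2 st i x : eval N env st e1 = i -> eval N env st e2 = x ->
  let st' := sem N env (CSet a e1 e2) st in
  st' a i = x /\ forall b j, (b != a) || (j != i) -> st' b j = st b j.
Proof.
move=> <- <- /=; rewrite /upd2 !eqxx; split=> // b j h.
by case: eqP h => //= _; case: eqP.
Qed.

(** * Indices of directed edges and of candidates *)

Section Instance.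

Variables (n : nat) (E : seq tedge) (S : seq nat).
Hypotheses (wfE : wf_tgraph n E) (treeE : is_tree n E) (sizeS : all (fun s => s < n) S).

Let M := size E.
Let inp := enc_instance n E S.
Let N := 16 * size inp.

Lemma size_inp : size inp = 3 + (M + (M + M)) + size S.
Proof. by rewrite /inp /enc_instance !size_cat /= size_enc_edges -/M; lia. Qed.

Lemma nth_inp0 : nth 0 inp 0 = n. Proof. by []. Qed.
Lemma nth_inp1 : nth 0 inp 1 = M. Proof. by []. Qed.

Lemma nth_inp_edge i : i < M + (M + M) -> nth 0 inp i.+2 = nth 0 (enc_edges E) i.
Proof.
by move=> hi; rewrite /inp /enc_instance nth_cat /= !ltnS size_enc_edges hi.
Qed.

Lemma nth_inp_S : nth 0 inp (2 + (M + (M + M))) = size S.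
Proof.
by rewrite /inp /enc_instance nth_cat /= !ltnS size_enc_edges ltnn subnn.
Qed.

Lemma nth_inp_source j : nth 0 inp (3 + j + (M + (M + M))) = nth 0 S j.
Proof.
rewrite /inp /enc_instance nth_cat /= size_enc_edges -/M.
have -> : (3 + j + (M + (M + M)) < (M + (M + M)).+2) = false by lia.
by have -> : 3 + j + (M + (M + M)) - (M + (M + M)).+2 = j.+1 by lia.
Qed.

Definition edge_at (k : nat) : tedge := nth (0, 0, 0) E k.

(* Each time-edge gives two directed ones, [k] and [k + M]; the indices beyond
   [2M] are loops at the non-vertex [n], which no computation can notice. *)
Definition tail (k : nat) : nat :=
  if k < M then (edge_at k).1.1 else if k < M + M then (edge_at (k - M)).1.2 else n.
Definition head (k : nat) : nat :=
  if k < M then (edge_at k).1.2 else if k < M + M then (edge_at (k - M)).1.1 else n.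
Definition label (k : nat) : nat :=
  if k < M then (edge_at k).2 else if k < M + M then (edge_at (k - M)).2 else 0.
Definition flip (k : nat) : nat := if k < M then k + M else k - M.

Lemma flip_spec k : k < M + M ->
  [/\ flip k < M + M, tail (flip k) = head k, head (flip k) = tail k
    & label (flip k) = label k].
Proof.
move=> hk; rewrite /flip /tail /head /label; case: (ltnP k M) => h.
  have -> : (k + M < M) = false by lia.
  have -> : k + M < M + M by lia.
  by rewrite addnK.
have -> : k - M < M by lia.
by rewrite hk; split=> //; lia.
Qed.

Lemma edge_has k : k < M + M -> has_tedge E (tail k) (head k) (label k).
Proof.
move=> hk; rewrite /tail /head /label hk; case: ltnP => h; rewrite /has_tedge.
  by rewrite -!surjective_pairing mem_nth.
by rewrite -!surjective_pairing (mem_nth _ (_ : k - M < size E)) ?orbT // -/M; lia.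
Qed.

Lemma edge_adj k : k < M + M -> sedge E (tail k) (head k).
Proof. by move=> /edge_has h; apply/sedgeP; exists (label k). Qed.

Lemma edge_index u v t : has_tedge E u v t ->
  exists k, [/\ k < M + M, tail k = u, head k = v & label k = t].
Proof.
case/orP => /(nthP (0, 0, 0))[k hk e]; [exists k|exists (k + M)].
  by rewrite /tail /head /label hk /edge_at e; split=> //; rewrite -/M in hk *; lia.
rewrite -/M in hk; rewrite /tail /head /label /edge_at.
have -> : (k + M < M) = false by lia.
have -> : k + M < M + M by lia.
by rewrite addnK e.
Qed.

Lemma adj_index u v : sedge E u v -> exists k, [/\ k < M + M, tail k = u & head k = v].
Proof. by case/sedgeP => t /edge_index[k [h1 h2 h3 _]]; exists k. Qed.

Lemma edge_lt k : k < M + M -> tail k < n /\ head k < n.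
Proof. by move/edge_adj/(adj_wf wfE)/and3P => [h1 h2 _]. Qed.

Lemma edge_junk k : M + M <= k -> tail k = n /\ head k = n.
Proof.
move=> h; rewrite /tail /head.
have -> : (k < M) = false by lia.
by have -> : (k < M + M) = false by lia.
Qed.

(** With two or more vertices, connectedness makes every vertex the tail of a directed edge. This
    bounds [n] by the input length and shows that [N] rounds of the iteration suffice. *)
Lemma n_le : n <= (M + M).+1.
Proof.
case: (leqP n 1) => [h|hn]; first by lia.
suff : size (iota 0 n) <= size (map tail (iota 0 (M + M))).
  by rewrite size_map !size_iota; exact: leqW.
apply: uniq_leq_size; first exact: iota_uniq.
move=> u; rewrite mem_iota => hu.
have [w hw huw] : exists2 w, w < n & u != w.
  by case: (posnP u) => h; [exists 1|exists 0] => //; lia.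
have [_ [hcon _]] := treeE; have [[|x p] /andP[]] := hcon u w hu hw.
  by rewrite /= (negbTE huw).
case/andP => /adj_index[k [hk <- _]] _ _; apply/mapP; exists k => //.
by rewrite mem_iota.
Qed.

Lemma N_large : 48 + 16 * (M + (M + M)) + 16 * size S = N.
Proof. by rewrite /N size_inp; lia. Qed.

(* The pair (a, a) stands for a center that is the vertex a. *)
Definition cand_a (c : nat) : nat := if c < M + M then tail c else c - (M + M).
Definition cand_b (c : nat) : nat := if c < M + M then head c else c - (M + M).

Lemma cand_index a b : a < n -> a = b \/ sedge E a b ->
  exists c, [/\ c < N, cand_a c = a & cand_b c = b].
Proof.
move=> ha; have := n_le; have := N_large => hN hn; case=> [<-|/adj_index[k [hk h1 h2]]].
  exists (M + M + a); rewrite /cand_a /cand_b.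
  have -> : (M + M + a < M + M) = false by lia.
  by split; lia.
by exists k; rewrite /cand_a /cand_b hk; split=> //; lia.
Qed.

Definition big : nat := (\max_(k < N) label k).+1.
Definition gap (P : pred nat) : nat := \max_(k < N) (if P k then big - label k else 0).
Definition same (u v k : nat) : bool := (tail k == u) && (head k == v).
Definition first_label (u v : nat) : nat := big - gap (same u v).
Definition second_label (u v : nat) : nat :=
  let g := gap (fun k => same u v k && (label k != first_label u v)) in
  if g == 0 then 0 else big - g.

Lemma label_big k : k < N -> label k < big.
Proof. by move=> hk; rewrite ltnS (leq_bigmax (Ordinal hk)). Qed.

Lemma gap_le (P : pred nat) k : k < N -> P k -> big - label k <= gap P.
Proof.
move=> hk hP; have := @leq_bigmax _ (fun k : 'I_N => if P k then big - label k else 0) (Ordinal hk).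
by rewrite /= hP.
Qed.

Lemma gap_ex (P : pred nat) : 0 < gap P -> exists k, [/\ k < N, P k & gap P = big - label k].
Proof.
move=> h; have hN : 0 < #|'I_N| by rewrite card_ord -N_large.
have [k e] := eq_bigmax (fun k : 'I_N => if P k then big - label k else 0) hN.
exists k; move: h; rewrite /gap e; case: ifP => // hP _; by split.
Qed.

Lemma same_index u v k : u < n -> same u v k -> k < M + M.
Proof.
move=> hu /andP[/eqP e _]; rewrite ltnNge; apply/negP => /edge_junk[e' _]; lia.
Qed.

(** This is the hypothesis [lowest] on candidates, for the labels that the program computes. *)
Lemma labels_spec u v : sedge E u v ->
  [/\ has_tedge E u v (first_label u v),
      forall t, has_tedge E u v t -> first_label u v <= t,
      forall t, has_tedge E u v t -> t != first_label u v -> 0 < second_label u v <= t &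
      0 < second_label u v ->
        has_tedge E u v (second_label u v) /\ second_label u v != first_label u v].
Proof.
move=> huv; have /and3P[hu _ _] := adj_wf wfE huv; have hN := N_large.
have [k0 [hk0 ht0 hh0]] := adj_index huv.
have hs0 : same u v k0 by rewrite /same ht0 hh0 !eqxx.
have hk0N : k0 < N by lia.
have hg : 0 < gap (same u v).
  by apply: leq_trans (gap_le hk0N hs0); rewrite subn_gt0 label_big.
have [k1 [hk1 hs1 e1]] := gap_ex hg.
have ef : first_label u v = label k1.
  by rewrite /first_label e1 subKn // ltnW // label_big.
have has_of k : same u v k -> has_tedge E u v (label k).
  by move=> hs; have := edge_has (same_index hu hs); case/andP: hs => /eqP-> /eqP->.
have of_has t : has_tedge E u v t -> exists k, [/\ k < N, same u v k & label k = t].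
  case/edge_index => k [hk h1 h2 h3]; exists k; rewrite /same h1 h2 !eqxx; split=> //; lia.
pose P := fun k => same u v k && (label k != first_label u v).
have second_ex : 0 < gap P -> exists2 k, P k & second_label u v = label k.
  move=> h; have [k [hk hP e]] := gap_ex h; exists k => //.
  rewrite /second_label -/P eqn0Ngt h /= e subKn // ltnW // label_big //.
split.
- by rewrite ef; exact: has_of.
- move=> t /of_has[k [hk hs <-]]; rewrite ef.
  have := gap_le hk hs; rewrite e1; have := label_big hk; have := label_big hk1; lia.
- move=> t /of_has[k [hk hs <-]] hne.
  have hP : P k by rewrite /P hs.
  have hgk := gap_le hk hP; have hkb := label_big hk.
  have hgP : 0 < gap P by lia.
  have [k2 hP2 e2] := second_ex hgP; rewrite e2.
  have /andP[hs2 _] := hP2.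
  have /and4P[_ _ _ ->] := tedge_wf wfE (has_of _ hs2).
  rewrite -e2 /second_label -/P eqn0Ngt hgP /=; lia.
- move=> h; have hgP : 0 < gap P.
    by move: h; rewrite /second_label -/P; case: (posnP (gap P)).
  have [k2 /andP[hs2 hne] e2] := second_ex hgP; rewrite e2; split=> //.
  exact: has_of.
Qed.

(** * Preparation of the arrays *)

Let hN : 48 + 16 * (M + (M + M)) + 16 * size S = N := N_large.
Let hn : n <= (M + M).+1 := n_le.

(** One cell less than [N], because the input loop shifts machine cells down by one. *)
Definition raw (st : store) : Prop := forall i, i < N.-1 -> st 0 i = nth 0 inp i.

Definition base (st : store) : Prop :=
  [/\ raw st,
      forall k, k < N -> [/\ st 1 k = tail k, st 2 k = head k & st 3 k = label k],
      forall k, k < M + M -> st 4 k = first_label (tail k) (head k),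
      forall k, k < M + M -> st 5 k = second_label (tail k) (head k) &
      forall v, v < N -> st 6 v = sources S v].

Lemma base_frame st st' : (forall b j, b < 7 -> st' b j = st b j) -> base st -> base st'.
Proof.
move=> h [h1 h2 h3 h4 h5]; split=> [i hi|k hk|k hk|k hk|v hv].
- by rewrite h ?h1.
- by rewrite !h //; exact: h2.
- by rewrite h ?h3.
- by rewrite h ?h4.
- by rewrite h ?h5.
Qed.

Lemma ev_M env st : raw st -> eval N env st eM = M.
Proof. by move=> h; rewrite /= h ?nth_inp1 //; lia. Qed.

Lemma ev_Triple env st k o kk : raw st -> eval N env st k = kk -> kk < M -> o < 5 -> 1 < o ->
  eval N env st (eTriple k o) = nth 0 (enc_edges E) (kk + (kk + kk) + (o - 2)).
Proof.
move=> h /= -> hk ho ho'; rewrite h; last by lia.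
have -> : o + (kk + (kk + kk)) = (kk + (kk + kk) + (o - 2)).+2 by lia.
by rewrite nth_inp_edge //; lia.
Qed.

Lemma cEdge_ok env st a o o' d f : raw st -> 1 < o < 5 -> 1 < o' < 5 -> 0 < a ->
  (forall k, k < M -> nth 0 (enc_edges E) (k + (k + k) + (o - 2)) = f k) ->
  (forall k, k < M -> nth 0 (enc_edges E) (k + (k + k) + (o' - 2)) = f (k + M)) ->
  (forall k st' env', M + M <= k -> raw st' -> eval N env' st' d = f k) ->
  let st' := sem N env (cEdge a o o' d) st in
  (forall k, k < N -> st' a k = f k) /\ forall b j, b != a -> st' b j = st b j.
Proof.
move=> hr ho ho' ha f1 f2 f3; have [k st' hk hst|h1 h2] := @fill N env st 0 a
  (EIf (ESub eM (EV 0)) (eTriple (EV 0) o)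
       (EIf (ESub e2M (EV 0)) (eTriple (ESub (EV 0) eM) o') d)) f.
  have hr' : raw st'.
    by move=> i hi; rewrite hst ?hr //; lia.
  rewrite !ev_If !ev_Sub ev_Add !ev_M // !ev_V /upd eqxx.
  case: (leqP M k) => hM; last by rewrite (@ev_Triple _ _ _ _ k) ?f1 //; lia.
  case: (leqP (M + M) k) => h2M; first exact: f3.
  rewrite (@ev_Triple _ _ _ _ (k - M)) ?f2 ?subnK //; try lia.
  by rewrite ev_SubE ev_M.
by split=> // b j hb; rewrite h2 ?hb.
Qed.

Lemma setup_ok env st : raw st ->
  let st' := sem N env setup st in base st' /\ st' 15 1 = 0.
Proof.
move=> hr; rewrite /setup.
rewrite sem_cons; have [k hk|k hk|k st' env' hk h|t1 f1] := @cEdge_ok env st 1 2 3 (ER 0 (EC 0)) tail hr isT isT isT.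
- by rewrite addn0; have [-> _ _] := nth_enc_edges hk; rewrite /tail hk.
- rewrite addn1; have [_ -> _] := nth_enc_edges hk.
  rewrite /tail; have -> : (k + M < M) = false by lia.
  have -> : k + M < M + M by lia.
  by rewrite addnK.
- rewrite /= h ?nth_inp0; last by lia.
  by case: (edge_junk hk).
have hr1 : raw (sem N env (cEdge 1 2 3 (ER 0 (EC 0))) st).
  by move=> i hi; rewrite f1 ?hr.
move: (sem N env _ st) t1 hr1 => st1 t1 hr1 {f1 hr st}.
rewrite sem_cons; have [k hk|k hk|k st' env' hk h|t2 f2] := @cEdge_ok env st1 2 3 2 (ER 0 (EC 0)) head hr1 isT isT isT.
- by rewrite addn1; have [_ -> _] := nth_enc_edges hk; rewrite /head hk.
- rewrite addn0; have [-> _ _] := nth_enc_edges hk.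
  rewrite /head; have -> : (k + M < M) = false by lia.
  have -> : k + M < M + M by lia.
  by rewrite addnK.
- rewrite /= h ?nth_inp0; last by lia.
  by case: (edge_junk hk).
have hr2 : raw (sem N env (cEdge 2 3 2 (ER 0 (EC 0))) st1).
  by move=> i hi; rewrite f2 ?hr1.
have t1' k : k < N -> sem N env (cEdge 2 3 2 (ER 0 (EC 0))) st1 1 k = tail k.
  by move=> hk; rewrite f2 ?t1.
move: (sem N env _ st1) t2 hr2 t1' => st2 t2 hr2 {}t1 {f2 hr1 st1}.
rewrite sem_cons; have [k hk|k hk|k st' env' hk h|t3 f3] := @cEdge_ok env st2 3 4 4 (EC 0) label hr2 isT isT isT.
- by rewrite addn2; have [_ _ ->] := nth_enc_edges hk; rewrite /label hk.
- rewrite addn2; have [_ _ ->] := nth_enc_edges hk.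
  rewrite /label; have -> : (k + M < M) = false by lia.
  have -> : k + M < M + M by lia.
  by rewrite addnK.
- rewrite /= /label.
  have -> : (k < M) = false by lia.
  by have -> : (k < M + M) = false by lia.
move: (sem N env _ st2) t3 f3 => st3 t3 f3.
have hr3 : raw st3 by move=> i hi; rewrite f3 ?hr2.
have {}t1 k : k < N -> [/\ st3 1 k = tail k, st3 2 k = head k & st3 3 k = label k].
  by move=> hk; rewrite (f3 1) // (f3 2) // t1 ?t2 ?t3.
move: t1 => {t2 t3 f3 hr2 st2} t.
rewrite sem_cons; set e5 := EAdd (EMax 0 _) _.
have e5E : eval N env st3 e5 = big.
  rewrite /e5 ev_Add ev_C addn1 ev_Max /big; congr _.+1; apply: eq_bigr => i _.
  by rewrite ev_R ev_V /upd /=; have [_ _ ->] := t i (ltn_ord i).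
have [b4 f4] := @sem_set N env 15 (EC 5) e5 st3 5 _ (erefl _) e5E.
move: (sem N env _ st3) b4 f4 => st4 b4 f4 {e5 e5E}.
have hr4 : raw st4 by move=> i hi; rewrite f4 ?hr3.
have {}t k : k < N -> [/\ st4 1 k = tail k, st4 2 k = head k & st4 3 k = label k].
  by move=> hk; rewrite !f4 //; exact: t.
move: t => {f4 hr3 st3} t.
have evgap env' st' k c (P : pred nat) : k < N ->
    (forall j, j < N -> (eval N (upd (upd env' 0 k) 1 j) st' c == 0) = ~~ P j) ->
    (forall j, j < N -> st' 3 j = label j) -> st' 15 5 = big ->
    eval N (upd env' 0 k) st' (eMinGap c) = gap P.
  move=> hk hc hl hb; rewrite /eMinGap ev_Max /gap; apply: eq_bigr => j _.
  rewrite ev_If hc // ev_SubE !ev_R ev_V /upd /= hl // hb.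
  by case: (P j).
have evsame env' st' k j : (forall k, k < N -> [/\ st' 1 k = tail k, st' 2 k = head k & st' 3 k = label k]) ->
    k < N -> j < N -> (eval N (upd (upd env' 0 k) 1 j) st' eSame == 0) = ~~ same (tail k) (head k) j.
  move=> ht hk hj; rewrite /eSame !evE /upd /=.
  have [-> -> _] := ht k hk; have [-> -> _] := ht j hj.
  by rewrite negb_and.
rewrite sem_cons; have [k st' hk hst|b5 f5] := @fill N env st4 0 4 (ESub eBig (eMinGap eSame))
    (fun k => first_label (tail k) (head k)).
  have ht k' : k' < N -> [/\ st' 1 k' = tail k', st' 2 k' = head k' & st' 3 k' = label k'].
    by move=> hk'; rewrite !hst //; exact: t.
  rewrite ev_SubE (@evgap _ _ _ _ (same (tail k) (head k))) //.
  - by rewrite /= hst // b4.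
  - by move=> j hj; rewrite evsame.
  - by move=> j hj; have [] := ht j hj.
  - by rewrite hst.
move: (sem N env _ st4) b5 f5 => st5 b5 f5.
have hr5 : raw st5 by move=> i hi; rewrite f5 ?hr4.
have big5 : st5 15 5 = big by rewrite f5.
have {}t k : k < N -> [/\ st5 1 k = tail k, st5 2 k = head k & st5 3 k = label k].
  by move=> hk; rewrite !f5 //; exact: t.
move: t => {f5 hr4 b4 st4} t.
rewrite sem_cons; have [k st' hk hst|b6 f6] := @fill N env st5 0 5 (EIf eGap2 (ESub eBig eGap2) (EC 0))
    (fun k => second_label (tail k) (head k)).
  have ht k' : k' < N -> [/\ st' 1 k' = tail k', st' 2 k' = head k' & st' 3 k' = label k'].
    by move=> hk'; rewrite !hst //; exact: t.
  have -> : eval N (upd env 0 k) st' (EIf eGap2 (ESub eBig eGap2) (EC 0)) =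
     let g := eval N (upd env 0 k) st' eGap2 in if g == 0 then 0 else st' 15 5 - g by [].
  rewrite /eGap2 (@evgap _ _ _ _ (fun j => same (tail k) (head k) j &&
      (label j != first_label (tail k) (head k)))) //.
  - by rewrite hst // big5.
  - move=> j hj; rewrite ev_And evsame // !evE /upd /= (hst 4) // b5 //.
    by have [_ _ ->] := ht j hj; rewrite negb_and negbK.
  - by move=> j hj; have [] := ht j hj.
  - by rewrite hst.
move: (sem N env _ st5) b6 f6 => st6 b6 f6.
have hr6 : raw st6 by move=> i hi; rewrite f6 ?hr5.
have b5' k : k < N -> st6 4 k = first_label (tail k) (head k).
  by move=> hk; rewrite f6 ?b5.
have {}t k : k < N -> [/\ st6 1 k = tail k, st6 2 k = head k & st6 3 k = label k].
  by move=> hk; rewrite !f6 //; exact: t.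
move: t => {f6 hr5 b5 big5 st5} t.
rewrite sem_cons; set eS := EMax _ _.
have [v st' hv hst|b7 f7] := @fill N env st6 0 6 eS (sources S).
  have hr' : raw st' by move=> i hi; rewrite hst ?hr6.
  have tri : eval N (upd env 0 v) st' (eTriple eM 2) = size S.
    rewrite /= !hr' ?nth_inp1; try lia.
    by rewrite nth_inp_S.
  rewrite /eS ev_Max /sources.
  have nthS j : j < size S -> st' 0 (3 + j + (M + (M + M))) = nth 0 S j.
    by move=> hj; rewrite hr' ?nth_inp_source //; lia.
  have trij j : eval N (upd (upd env 0 v) 1 j) st' (eTriple eM 2) = size S by [].
  case: (boolP (v \in S)) => hvS.
    have [j hj ej] := nthP 0 hvS; have hj1 : j < size S := hj.
    have hjN : j < N by lia.
    apply/eqP; rewrite eqn_leq; apply/andP; split.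
      apply/bigmax_leqP => i _; rewrite ev_If; by case: ifP.
    apply: leq_trans (@leq_bigmax _ _ (Ordinal hjN)).
    rewrite ev_If ev_And ev_Sub trij ev_Eq ev_R !ev_Add !ev_M // !ev_V !ev_C /upd /=.
    by rewrite nthS // ej eqxx (leqNgt (size S)) hj1.
  apply: big1 => j _; rewrite ev_If ev_And ev_Sub trij ev_Eq ev_R !ev_Add !ev_M // !ev_V !ev_C /upd /=.
  case: (leqP (size S) j) => //= hj; rewrite nthS //.
  by case: eqP => // e; case/negP: hvS; rewrite -e mem_nth.
move: (sem N env _ st6) b7 f7 => st7 b7 f7 {eS}.
have [b8 f8] := @sem_set N env 15 (EC 1) (EC 0) st7 1 0 (erefl _) (erefl _).
rewrite [cSeq _]/=; move: (sem N env _ st7) b8 f8 => st8 b8 f8; split=> //.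
split=> [i hi|k hk|k hk|k hk|v hv].
- by rewrite f8 ?f7 ?hr6.
- by rewrite !f8 ?f7 //; exact: t.
- by rewrite f8 ?f7 ?b5' //; lia.
- by rewrite f8 ?f7 ?b6 //; lia.
- by rewrite f8 ?b7.
Qed.

(** The supremum over neighbours becomes a maximum over directed edges. The loops beyond [M + M]
    drop out because their head [n] is no vertex. *)
Lemma max_edges Q (x : nat -> nat -> nat) (X : nat -> nat) k : k < M + M ->
  (forall j, j < M + M -> X j = x (tail j) (head j)) ->
  maxn (Q (tail k)) (\max_(j < N)
    (if [|| head j != tail k, tail j == head k | X j == 0] then 0 else (X j).+1)) =
  sup_in n E Q x (tail k) (head k).
Proof.
move=> hk hX; have [hkn _] := edge_lt hk.
apply/eqP; rewrite eqn_leq; apply/andP; split.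
  rewrite geq_max sup_in_geQ /=; apply/bigmax_leqP => j _.
  case: ifP => // /negbT; rewrite !negb_or negbK => /and3P[/eqP e1 h2 h3].
  have hj : j < M + M.
    by rewrite ltnNge; apply/negP => /edge_junk[_ e]; lia.
  have ha := edge_adj hj; move: h3 h2 ha; rewrite hX // e1 => h3 h2 ha.
  by apply: sup_in_ge => //; lia.
apply/sup_in_le => //; split; first exact: leq_maxl.
move=> w hw hwk hpos; have [j [hj e1 e2]] := adj_index hw.
have hjN : j < N by lia.
rewrite leq_max; apply/orP; right; apply: leq_trans (@leq_bigmax _ _ (Ordinal hjN)).
rewrite /= hX // e1 e2 eqxx (negbTE hwk) /=; case: eqP => //; lia.
Qed.

(** The loops at [n] keep time 0 if [Q] vanishes there. That holds for the sources, whereas a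
    candidate may name [n] as an end, so the clause is conditional. *)
Lemma iterate_ok env st q e Q lb L : base st -> q = 6 \/ q = 7 ->
  (forall v, v < N -> st q v = Q v) ->
  (forall k st' env', k < N -> (forall b j, b != 9 -> b != 10 -> st' b j = st b j) ->
     eval N (upd env' 2 k) st' e = L k) ->
  (forall k, k < M + M -> L k = lb (tail k) (head k)) ->
  let st' := sem N env (iterate q e) st in
  [/\ forall k, k < M + M -> st' 9 k = arrive n E N Q lb (tail k) (head k),
      Q n = 0 -> forall k, M + M <= k < N -> st' 9 k = 0 &
      forall b j, b != 9 -> b != 10 -> st' b j = st b j].
Proof.
move=> hb hq hQ he hL.
have q9 : (q != 9) && (q != 10) by case: hq => ->.
pose st1 := sem N env (CFor 1 (CSet 9 (EV 1) (EC 0))) st.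
pose body := CSeq (CFor 2 (CSet 10 (EV 2) (eSup q)))
                 (CFor 2 (CSet 9 (EV 2)
                    (EIf (ER 10 (EV 2)) (eMx (ER 10 (EV 2)) e) (EC 0)))).
rewrite /iterate sem_seq -/st1 -/body sem_for.
suff H r : let st' := iteri r (fun i => sem N (upd env 1 i) body) st1 in
    [/\ forall k, k < M + M -> st' 9 k = arrive n E r Q lb (tail k) (head k),
      Q n = 0 -> forall k, M + M <= k < N -> st' 9 k = 0 &
      forall b j, b != 9 -> b != 10 -> st' b j = st b j].
  exact: H N.
elim: r => [|r [IH1 IH2 IH3]].
  have [//|h1 h2] := @fill N env st 1 9 (EC 0) (fun=> 0).
  rewrite -/st1 in h1 h2; split=> [k hk|_ k hk|b j hb9 _] /=.
  - by rewrite h1 //; lia.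
  - by rewrite h1 //; lia.
  - by rewrite h2 ?hb9.
rewrite iteriS; move: (iteri r _ st1) IH1 IH2 IH3 => st2 IH1 IH2 IH3.
set env2 := upd env 1 r.
have hb2 : base st2 by apply: (base_frame _ hb) => b j hb'; rewrite IH3 //; lia.
pose f k := maxn (Q (tail k)) (\max_(j < N)
    (if [|| head j != tail k, tail j == head k | st2 9 j == 0] then 0 else (st2 9 j).+1)).
have tlN k : tail k < N.
  case: (ltnP k (M + M)) => h; first by have [h1 _] := edge_lt h; lia.
  by have [-> _] := edge_junk h; lia.
have [k st' hk hst|h3 f3] := @fill N env2 st2 2 10 (eSup q) f.
  have [_ t _ _ _] := hb2; have [tk hdk _] := t k hk.
  rewrite /eSup ev_Mx /f; congr maxn.
    rewrite /eU !evE /upd /= (hst 1) // tk (hst q) ?IH3 ?hQ //; lia.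
  rewrite ev_Max; apply: eq_bigr => j _; have [tj hdj _] := t j (ltn_ord j).
  rewrite ev_If !ev_And ev_Eq ev_Ne /eX !evE /upd /= !hst // tk hdk tj hdj.
  by rewrite addn1.
have {}f3 b j : b != 10 -> sem N env2 (CFor 2 (CSet 10 (EV 2) (eSup q))) st2 b j = st2 b j.
  by move=> h; rewrite f3 ?h.
rewrite /body sem_seq.
move: (sem N env2 _ st2) h3 f3 => st3 h3 f3.
have [k st' hk hst|h4 f4] := @fill N env2 st3 2 9
    (EIf (ER 10 (EV 2)) (eMx (ER 10 (EV 2)) e) (EC 0))
    (fun k => if f k == 0 then 0 else maxn (f k) (L k)).
  rewrite ev_If ev_Mx (he k) //; last first.
    by move=> b j hb9 hb10; rewrite hst ?f3 ?IH3 ?hb9.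
  by rewrite !evE /upd /= hst // h3.
move: (sem N env2 _ st3) h4 f4 => st4 h4 f4; split=> [k hk|hQn k hk|b j hb9 hb10].
- rewrite h4; last by lia.
  rewrite /f (max_edges Q hk IH1) hL //.
- rewrite h4; last by lia.
  suff -> : f k = 0 by [].
  have [e1 e2] := edge_junk (proj1 (andP hk)).
  rewrite /f e1 hQn max0n big1 // => j _.
  case: (ltnP j (M + M)) => hj; last first.
    by have [e3 e4] := edge_junk hj; rewrite e2 e3 e4 eqxx orbT.
  have [_ h] := edge_lt hj; have -> // : head j != n by lia.
- by rewrite f4 ?hb9 // f3 // IH3.
Qed.

(** * The phases of the computation for one candidate *)

Local Notation t1 := first_label.
Local Notation t2 := second_label.

Definition ctx (a b best : nat) (o : nat -> nat) (st : store) : Prop :=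
  [/\ base st, st 15 6 = a, st 15 7 = b, st 15 1 = best & forall j, st 14 j = o j].

Lemma ctx_frame a b best o st st' :
  (forall c j, (c < 7) || (c == 14) || ((c == 15) && ((j == 1) || (j == 6) || (j == 7))) ->
     st' c j = st c j) -> ctx a b best o st -> ctx a b best o st'.
Proof.
move=> h [h1 h2 h3 h4 h5]; split; rewrite ?h //.
- by apply: (base_frame _ h1) => c j hc; rewrite h // hc.
- by move=> j; rewrite h.
Qed.

Lemma ev_Rev env st k kk : raw st -> eval N env st k = kk ->
  eval N env st (eRev k) = flip kk.
Proof.
by move=> hr hk; rewrite ev_If ev_Sub ev_Add ev_SubE ev_M // hk /flip; case: leqP.
Qed.

Lemma set_center_ok env st c best o : base st -> st 15 1 = best -> (forall j, st 14 j = o j) ->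
  c < N -> env 0 = c -> let st' := sem N env set_center st in
  ctx (cand_a c) (cand_b c) best o st' /\
  forall v, v < N -> st' 7 v = ends (cand_a c) (cand_b c) v.
Proof.
move=> hb h1 h14 hc e0; rewrite /set_center.
have [hr t _ _ _] := hb; have [tc hdc _] := t c hc.
have ea : eval N env st (EIf (ESub e2M (EV 0)) (eU (EV 0)) (ESub (EV 0) e2M)) = cand_a c.
  rewrite ev_If ev_Sub ev_Add !ev_M // ev_V e0 /cand_a; case: leqP => _.
    by rewrite ev_SubE ev_V e0 ev_Add !ev_M.
  by rewrite /eU ev_R ev_V e0 tc.
have [b6 f6] := @sem_set N env 15 (EC 6) _ st 6 _ (erefl _) ea.
rewrite sem_cons; move: (sem N env _ st) b6 f6 => st1 b6 f6 {ea}.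
have hb1 : base st1 by apply: (base_frame _ hb) => b j hj; rewrite f6 //; lia.
have [hr1 t' _ _ _] := hb1; have [tc1 hdc1 _] := t' c hc.
have eb : eval N env st1 (EIf (ESub e2M (EV 0)) (eV (EV 0)) (ESub (EV 0) e2M)) = cand_b c.
  rewrite ev_If ev_Sub ev_Add !ev_M // ev_V e0 /cand_b; case: leqP => _.
    by rewrite ev_SubE ev_V e0 ev_Add !ev_M.
  by rewrite /eV ev_R ev_V e0 hdc1.
have [b7 f7] := @sem_set N env 15 (EC 7) _ st1 7 _ (erefl _) eb.
rewrite sem_cons; move: (sem N env _ st1) b7 f7 => st2 b7 f7 {eb}.
have hc2 : ctx (cand_a c) (cand_b c) best o st2.
  split=> //.
  - by apply: (base_frame _ hb1) => b j hj; rewrite f7 //; lia.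
  - by rewrite f7.
  - by rewrite f7 // f6.
  - by move=> j; rewrite f7 // f6.
have [v st' hv hst|h3 f3] := @fill N env st2 1 7
    (EIf (eOr (eEq (EV 1) eA) (eEq (EV 1) eB)) (EC 1) (EC 0)) (ends (cand_a c) (cand_b c)).
  have [_ e6 e7 _ _] := hc2; rewrite ev_If ev_Or !ev_Eq /eA /eB !evE /upd /= !hst // e6 e7.
  by rewrite /ends -negb_or; case: (_ || _).
split; last exact: h3.
by apply: ctx_frame hc2 => b j hbj; rewrite f3 //; lia.
Qed.

Lemma flags_ok env st a b best o : ctx a b best o st ->
  (forall v, v < N -> st 7 v = ends a b v) ->
  let st' := sem N env flags st in
  [/\ ctx a b best o st',
      forall k, k < M + M -> st' 11 k == 0 = ~~ usedb n E S N (tail k) (head k),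
      forall k, M + M <= k < N -> st' 11 k = 0 &
      forall k, k < M + M -> st' 13 k = lifted n E S N t2 a b (tail k) (head k)].
Proof.
move=> hc he; rewrite /flags; have [hb _ _ _ _] := hc; have [_ _ _ _ hs] := hb.
have sn : sources S n = 0.
  by rewrite /sources; case: (boolP (n \in S)) => // /(allP sizeS); rewrite ltnn.
have [||k st' env' hk hst|k hk|x1 j1 f1] := @iterate_ok env st 6 (EC 0) (sources S) free (fun=> 0) hb; try by [].
- by left.
rewrite sem_cons; move: (sem N env _ st) x1 (j1 sn) f1 => st1 x1 {}j1 f1.
have hc1 : ctx a b best o st1 by apply: ctx_frame hc => c j hj; rewrite f1 //; lia.
have [k st' hk hst|h2 f2] := @fill N env st1 1 11 (eX (EV 1)) (st1 9).
  by rewrite /eX !evE /upd /= hst.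
rewrite sem_cons; move: (sem N env _ st1) h2 f2 => st2 h2 f2.
have hc2 : ctx a b best o st2 by apply: ctx_frame hc1 => c j hj; rewrite f2 //; lia.
have he2 v : v < N -> st2 7 v = ends a b v by move=> hv; rewrite f2 // f1 // he.
have [hb2 _ _ _ _] := hc2.
have [||k st' env' hk hst|k hk|x3 _ f3] := @iterate_ok env st2 7 (EC 0) (ends a b) free (fun=> 0) hb2; try by [].
- by right.
rewrite sem_cons; move: (sem N env _ st2) x3 f3 => st3 x3 f3.
have hc3 : ctx a b best o st3 by apply: ctx_frame hc2 => c j hj; rewrite f3 //; lia.
have [k st' hk hst|h4 f4] := @fill N env st3 1 12 (eX (EV 1)) (st3 9).
  by rewrite /eX !evE /upd /= hst.
rewrite sem_cons; move: (sem N env _ st3) h4 f4 => st4 h4 f4.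
have hc4 : ctx a b best o st4 by apply: ctx_frame hc3 => c j hj; rewrite f4 //; lia.
have u4 k : k < N -> st4 11 k = st1 9 k by move=> hk; rewrite f4 // f3 // h2.
have used4 k : k < M + M -> st4 11 k == 0 = ~~ usedb n E S N (tail k) (head k).
  by move=> hk; rewrite u4 ?x1 /usedb ?eqn0Ngt //; lia.
have junk4 k : M + M <= k < N -> st4 11 k = 0.
  by move=> hk; rewrite u4 ?j1 //; lia.
have away4 k : k < M + M -> st4 12 k == 0 = ~~ awayb n E N a b (tail k) (head k).
  by move=> hk; rewrite h4 ?x3 /awayb ?eqn0Ngt //; lia.
have [[hr4 _ _ s4 _] _ _ _ _] := hc4.
have [k st' hk hst|h5 f5] := @fill N env st4 1 13
    (EIf (eAnd (eUsed (EV 1)) (eAnd (eUsed (eRev (EV 1)))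
               (eAnd (eAway (EV 1)) (eAnd (eNot (eAway (eRev (EV 1)))) (eT2 (EV 1))))))
           (EC 1) (EC 0))
    (fun k => if k < M + M then lifted n E S N t2 a b (tail k) (head k) : nat else 0).
  have hr' : raw st' by move=> i hi; rewrite hst // hr4.
  rewrite ev_If !ev_And ev_Not /eUsed /eAway /eT2 !ev_R !(@ev_Rev _ _ _ k) // !ev_V /upd eqxx !hst //.
  case: (ltnP k (M + M)) => hkM; last by rewrite junk4 ?hkM.
  have [g1 g2 g3 _] := flip_spec hkM.
  rewrite used4 // used4 // !away4 // g2 g3 s4 // !negbK /lifted lt0n.
  by case: (usedb _ _ _ _ _); case: (usedb _ _ _ _ _); case: (awayb _ _ _ _ _ _ _); case: (awayb _ _ _ _ _ _ _); case: eqP.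
rewrite [cSeq _]/=; move: (sem N env _ st4) h5 f5 => st5 h5 f5; split=> [|k hk|k hk|k hk].
- by apply: ctx_frame hc4 => c j hj; rewrite f5 //; lia.
- by rewrite f5 // used4.
- by rewrite f5 // junk4.
- by rewrite h5 ?hk //; lia.
Qed.

Local Notation usedb := (usedb n E S N).
Local Notation lifted := (lifted n E S N t2).
Local Notation early := (early n E S N t1 t2).
Local Notation late := (late n E S N t1 t2).

Lemma times_ok env st a b best o : ctx a b best o st ->
  (forall k, k < M + M -> st 13 k = lifted a b (tail k) (head k)) ->
  let st' := sem N env times st in
  [/\ ctx a b best o st',
      forall k, st' 11 k = st 11 k,
      forall k, st' 13 k = st 13 k,
      forall k, k < M + M -> st' 9 k = late a b (tail k) (head k) &
      forall k, M + M <= k < N -> st' 9 k = 0].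
Proof.
move=> hc hl; rewrite /times; have [[hr t u1 u2 hs] _ _ _ _] := hc.
have sn : sources S n = 0.
  by rewrite /sources; case: (boolP (n \in S)) => // /(allP sizeS); rewrite ltnn.
have [k st' hk hst|h1 f1] := @fill N env st 1 8 (EIf (eLift (EV 1)) (eT2 (EV 1)) (eT1 (EV 1)))
    (fun k => if st 13 k == 0 then st 4 k else st 5 k).
  by rewrite /eLift /eT1 /eT2 !evE /upd /= !hst.
rewrite sem_cons; move: (sem N env _ st) h1 f1 => st1 h1 f1.
have hc1 : ctx a b best o st1 by apply: ctx_frame hc => c j hj; rewrite f1 //; lia.
have b1 k : k < M + M -> st1 8 k = bound1 n E S N t1 t2 a b (tail k) (head k).
  move=> hk; rewrite h1 ?hl ?u1 ?u2 //; last by lia.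
  by rewrite /bound1; case: (lifted _ _ _ _).
have [hb1 _ _ _ _] := hc1.
have [||k st' env' hk hst|k hk|x2 j2 f2] := @iterate_ok env st1 6 (ER 8 (EV 2)) (sources S)
    (bound1 n E S N t1 t2 a b) (fun k => st1 8 k) hb1; try by [].
- by left.
- by move=> v hv; rewrite f1 // hs.
- by rewrite ev_R ev_V /upd eqxx hst.
- exact: b1.
rewrite sem_cons; move: (sem N env _ st1) x2 f2 => st2 x2 f2.
have hc2 : ctx a b best o st2 by apply: ctx_frame hc1 => c j hj; rewrite f2 //; lia.
have [[hr2 t' _ _ hs2] ea eb _ _] := hc2.
have [k st' hk hst|h3 f3] := @fill N env st2 1 8 (eMx (ER 8 (EV 1))
        (EIf eCenter (eMx (eX (EV 1)) (eX (eRev (EV 1)))) (EC 0)))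
    (fun k => maxn (st1 8 k) (if is_center a b (tail k) (head k)
       then maxn (st2 9 k) (st2 9 (flip k)) else 0)).
  have hr' : raw st' by move=> i hi; rewrite hst // hr2.
  have [tk hk' _] := t' k hk.
  rewrite ev_Mx; congr maxn.
    by rewrite ev_R ev_V /upd eqxx hst ?leqnn ?orbT // f2.
  rewrite ev_If ev_Mx /eX !ev_R !(@ev_Rev _ _ _ k) ?ev_V /upd ?eqxx // !hst //.
  rewrite /eCenter ev_Or !ev_And !ev_Eq /eU /eV /eA /eB !ev_R !ev_V !ev_C /upd eqxx !hst //.
  rewrite tk hk' ea eb /is_center.
  by case: (_ == a); case: (_ == b); case: (_ == b); case: (_ == a).
rewrite sem_cons; move: (sem N env _ st2) h3 f3 => st3 h3 f3.
have hc3 : ctx a b best o st3 by apply: ctx_frame hc2 => c j hj; rewrite f3 //; lia.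
have [hb3 _ _ _ _] := hc3.
have [||k st' env' hk hst|k hk|x4 j4 f4] := @iterate_ok env st3 6 (ER 8 (EV 2)) (sources S)
    (bound2 n E S N t1 t2 a b) (fun k => st3 8 k) hb3; try by [].
- by left.
- by move=> v hv; rewrite f3 // hs2.
- by rewrite ev_R ev_V /upd eqxx hst.
- have [g1 g2 g3 _] := flip_spec hk.
  rewrite h3 ?b1 ?x2 // ?g2 ?g3 //; lia.
rewrite [cSeq _]/=; move: (sem N env _ st3) x4 (j4 sn) f4 => st4 x4 {}j4 f4; split=> //.
- by apply: ctx_frame hc3 => c j hj; rewrite f4 //; lia.
- by move=> k; rewrite f4 // f3 // f2 // f1.
- by move=> k; rewrite f4 // f3 // f2 // f1.
Qed.

Local Notation accepted := (accepted n E S N t1 t2).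
Local Notation score := (score n E S N t1 t2).
Local Notation new_label := (new_label n E S N t1 t2).

Lemma decide_ok env st a b best o : ctx a b best o st ->
  (forall k, k < M + M -> st 11 k == 0 = ~~ usedb (tail k) (head k)) ->
  (forall k, M + M <= k < N -> st 11 k = 0) ->
  (forall k, k < M + M -> st 13 k = lifted a b (tail k) (head k)) ->
  (forall k, k < M + M -> st 9 k = late a b (tail k) (head k)) ->
  (forall k, M + M <= k < N -> st 9 k = 0) ->
  let st' := sem N env decide st in
  exists V (better : bool),
  [/\ base st', score a b V,
      better <-> accepted a b /\ (best == 0) || (V.+1 < best),
      st' 15 1 = (if better then V.+1 else best) &
      forall k, k < M + M ->
        st' 14 k = if better then new_label a b (tail k) (head k) (label k) else o k].
Proof.
move=> hc hu ju hl hx jx; rewrite /decide; have [[hr t u1 u2 hs] _ _ _ _] := hc.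
pose bad k := [&& st 11 k != 0, st 11 (flip k) != 0, st 13 k == 0, st 13 (flip k) == 0
   & st 9 k != st 9 (flip k)].
set eBadE := EMax _ _.
have ebad : eval N env st eBadE = \max_(k < N) (bad k).
  rewrite /eBadE ev_Max; apply: eq_bigr => k _.
  rewrite ev_If !ev_And !ev_Not ev_Ne /eUsed /eLift /eX !ev_R !(@ev_Rev _ _ _ k) //
    ?ev_V /upd ?eqxx // !ev_C /bad.
  by case: (st 11 k == 0); case: (st 11 _ == 0); case: (st 13 k == 0);
    case: (st 13 _ == 0); case: (st 9 k == _).
have [b1 f1] := @sem_set N env 15 (EC 0) _ st 0 _ (erefl _) ebad.
rewrite sem_cons; move: (sem N env _ st) b1 f1 => st1 b1 f1 {ebad eBadE}.
have eval9 : eval N env st1 (EMax 1 (eX (EV 1))) = \max_(k < N) st 9 k.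
  by rewrite ev_Max; apply: eq_bigr => k _; rewrite /eX ev_R ev_V /upd eqxx f1.
have [b2 f2] := @sem_set N env 15 (EC 4) _ st1 4 _ (erefl _) eval9.
rewrite sem_cons; move: (sem N env _ st1) b2 f2 => st2 b2 f2 {eval9}.
set V := \max_(k < N) st 9 k in b2.
have b1' : st2 15 0 = \max_(k < N) (bad k) by rewrite f2.
have hc2 : ctx a b best o st2.
  by apply: ctx_frame hc => c j hj; rewrite f2 ?f1 //; lia.
have [_ _ _ best2 _] := hc2.
pose better := (\max_(k < N) (bad k) == 0) && ((best == 0) || (V.+1 < best)).
set eBetE := eAnd _ _.
have ebet : (eval N env st2 eBetE == 0) = ~~ better.
  rewrite /eBetE ev_And ev_Not ev_If /eBad /eBest ev_SubE ev_Add /eVal !ev_R !ev_C b1' b2 best2.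
  rewrite /better negb_and; congr (_ || _); case: (best == 0) => //=.
  by rewrite subn_eq0 addn1 leqNgt.
have [b3 f3] := @sem_set N env 15 (EC 2) _ st2 2 _ (erefl _) (erefl (eval N env st2 eBetE)).
rewrite sem_cons; move: (sem N env _ st2) b3 f3 => st3 b3 f3.
have hbet : (st3 15 2 == 0) = ~~ better by rewrite b3.
have hc3 : ctx a b best o st3.
  by apply: ctx_frame hc2 => c j hj; rewrite f3 //; lia.
have val3 : st3 15 4 = V by rewrite f3.
have [[hr3 t3 u3 _ _] _ _ best3 o3] := hc3.
have a9 k : st3 9 k = st 9 k by rewrite f3 // f2 // f1.
have a13 k : st3 13 k = st 13 k by rewrite f3 // f2 // f1.
(* The index [k] names the time-edge to be relabelled and [d] the direction that offers its time;
   for the reverse direction [d] is [flip k]. *)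
pose con k d := if (if st 13 d == 0 then label k == st3 4 d else label k != st3 4 d) then st 9 d else 0.
have econ k st' e d : k < N -> eval N (upd env 1 k) st' e = d ->
    (forall b j, (b != 14) || (k <= j) -> st' b j = st3 b j) ->
    eval N (upd env 1 k) st' (eContrib e) = con k d.
  move=> hk he hst; have [_ _ lk] := t3 k hk.
  rewrite /eContrib ev_If ev_If /eLift /eX !ev_R !he !hst // a9 a13 /con.
  case: (st 13 d == 0).
    by rewrite ev_Eq /eT /eT1 !ev_R he ev_V /upd eqxx !hst // lk; case: (_ == _).
  by rewrite ev_Ne /eT /eT1 !ev_R he ev_V /upd eqxx !hst // lk; case: (_ == _).
have [k st' hk hst|h4 f4] := @fill N env st3 1 14 (EIf eBetter
        (eMx (eT (EV 1)) (eMx (eContrib (EV 1)) (eContrib (eRev (EV 1)))))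
        (ER 14 (EV 1)))
    (fun k => if better then maxn (label k) (maxn (con k k) (con k (flip k))) else o k).
  have hr' : raw st' by move=> i hi; rewrite hst // hr3.
  rewrite ev_If {1}/eBetter ev_R ev_C hst // hbet.
  have evk : eval N (upd env 1 k) st' (EV 1) = k by rewrite ev_V /upd eqxx.
  case: (better); rewrite [~~ _]/=; last by rewrite ev_R evk hst ?leqnn ?orbT // o3.
  rewrite !ev_Mx (@econ k _ _ k) // (@econ k _ _ (flip k)) //; last exact: ev_Rev.
  by rewrite /eT ev_R evk hst //; have [_ _ ->] := t3 k hk.
rewrite sem_cons; move: (sem N env _ st3) h4 f4 => st4 h4 f4.
set eLast := EIf _ _ _.
have elast : eval N env st4 eLast = if better then V.+1 else best.
  rewrite /eLast ev_If ev_Add /eBetter /eVal /eBest !ev_R !ev_C !f4 // hbet val3 best3 addn1.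
  by case: (better).
have [b5 f5] := @sem_set N env 15 (EC 1) _ st4 1 _ (erefl _) elast.
rewrite [cSeq _]/= -/eLast; move: (sem N env _ st4) b5 f5 => st5 b5 f5.
have badP : (\max_(k < N) (bad k) == 0) <-> accepted a b.
  have hbk k : k < M + M -> bad k = [&& usedb (tail k) (head k), usedb (head k) (tail k),
      ~~ lifted a b (tail k) (head k), ~~ lifted a b (head k) (tail k) &
      late a b (tail k) (head k) != late a b (head k) (tail k)].
    move=> hk; have [g1 g2 g3 _] := flip_spec hk.
    by rewrite /bad !hu // !hl // !hx // g2 g3 !negbK !eqb0.
  split.
    rewrite -leqn0 => /bigmax_leqP h u v /adj_index[k [hk <- <-]] used1 used2.
    have hkN : k < N by lia.
    have := h (Ordinal hkN) isT; rewrite /= hbk // used1 used2 /=.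
    by case: (lifted _ _ _ _); case: (lifted _ _ _ _); case: eqP.
  move=> hacc; rewrite -leqn0; apply/bigmax_leqP => k _.
  case: (ltnP k (M + M)) => hk; last by rewrite /bad ju // hk ltn_ord.
  rewrite hbk // leqn0 eqb0; apply/negP => /and5P[used1 used2 l1 l2 ne].
  have := hacc _ _ (edge_adj hk) used1 used2.
  by rewrite (negbTE l1) (negbTE l2) (negbTE ne).
exists V, better; split.
- have [hb3 _ _ _ _] := hc3; apply: (base_frame _ hb3) => c j hj.
  by rewrite f5 ?f4 //; lia.
- move=> W; split.
    move=> hW u v /adj_index[k [hk <- <-]]; apply: leq_trans hW; rewrite -hx //.
    have hkN : k < N by lia.
    exact: (@leq_bigmax _ (fun k : 'I_N => st 9 k) (Ordinal hkN)).
  move=> h; apply/bigmax_leqP => k _.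
  case: (ltnP k (M + M)) => hk; last by rewrite jx // hk ltn_ord.
  by rewrite hx //; apply: h; exact: edge_adj.
- rewrite /better; split; first by case/andP => /badP.
  by case=> /badP -> ->.
- by [].
- move=> k hk; have hkN : k < N by lia.
  rewrite f5 // h4 //; case: (better) => //.
  have [g1 g2 g3 _] := flip_spec hk.
  rewrite /new_label /con /contrib !hl // !hx // !u3 // g2 g3 !eqb0.
  by congr (maxn _ (maxn _ _)); case: (lifted _ _ _ _).
Qed.

Lemma candidate_ok env st c : base st -> c < N -> env 0 = c ->
  let st' := sem N env candidate st in
  exists V (better : bool),
  [/\ base st', score (cand_a c) (cand_b c) V,
      better <-> accepted (cand_a c) (cand_b c) /\ (st 15 1 == 0) || (V.+1 < st 15 1),
      st' 15 1 = (if better then V.+1 else st 15 1) &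
      forall k, k < M + M -> st' 14 k =
        if better then new_label (cand_a c) (cand_b c) (tail k) (head k) (label k)
        else st 14 k].
Proof.
move=> hb hc e0; rewrite /candidate (sem_seq _ _ set_center) (sem_seq _ _ flags) (sem_seq _ _ times).
have [h1 h2] := @set_center_ok env st c (st 15 1) (st 14) hb (erefl _) (fun=> erefl _) hc e0.
have [h3 h4 h5 h6] := @flags_ok env _ _ _ _ _ h1 h2.
have [h7 h8 h9 h10 h11] := @times_ok env _ _ _ _ _ h3 h6.
have [k hk|k hk|k hk|||V [better hV]] := @decide_ok env _ _ _ _ _ h7; try by [].
- by rewrite h8 h4.
- by rewrite h8 h5.
- by rewrite h9 h6.
by exists V, better; exact: hV.
Qed.

(** * The search over all centers *)

Definition best_upto (i : nat) (st : store) : Prop :=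
  (st 15 1 = 0 /\ forall c, c < i -> ~ accepted (cand_a c) (cand_b c)) \/
  exists a b V, [/\ accepted a b, score a b V, st 15 1 = V.+1,
    forall k, k < M + M -> st 14 k = new_label a b (tail k) (head k) (label k) &
    forall c W, c < i -> accepted (cand_a c) (cand_b c) ->
      score (cand_a c) (cand_b c) W -> V <= W].

Lemma score_uniq a b V W : score a b V -> score a b W -> V <= W.
Proof. by move=> hV hW; apply/(hV W); apply/(hW W). Qed.

Lemma score_ex a b : exists V, score a b V.
Proof.
exists (\max_(k < M + M) late a b (tail k) (head k)) => W; split.
  move=> hW u v /adj_index[k [hk <- <-]]; apply: leq_trans hW.
  exact: (@leq_bigmax _ (fun k : 'I_(M + M) => late a b (tail k) (head k)) (Ordinal hk)).
by move=> h; apply/bigmax_leqP => k _; apply: h; exact: edge_adj.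
Qed.

Lemma candidates_ok env st : base st -> st 15 1 = 0 ->
  let st' := sem N env (CFor 0 candidate) st in base st' /\ best_upto N st'.
Proof.
move=> hb h0; rewrite sem_for.
suff H i : i <= N -> let st' := iteri i (fun i => sem N (upd env 0 i) candidate) st in
    base st' /\ best_upto i st' by exact: H.
elim: i => [|i IH] hi; first by split=> //; left.
have {IH} [hb1 hbest] := IH (ltnW hi); rewrite iteriS.
move: (iteri i _ st) hb1 hbest => st1 hb1 hbest.
have [V [better [g1 g2 g3 g4 g5]]] := @candidate_ok (upd env 0 i) st1 i hb1 hi (upd_eq _ _ _).
split=> //; move: (sem N _ candidate st1) g1 g4 g5 => st2 g1 g4 g5.
case: better g3 g4 g5 => g3 g4 g5.
  have [hacc hbt] := g3.1 isT; right; exists (cand_a i), (cand_b i), V; split=> // c W.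
  rewrite ltnS leq_eqVlt => /orP[/eqP -> _|hc hacc' hW]; first exact: score_uniq.
  case: hbest => [[_ hno]|[a [b [V0 [_ _ e1 _ hmin]]]]]; first by case: (hno c hc).
  have := hmin c W hc hacc' hW; move: hbt; rewrite e1; lia.
case: hbest => [[e1 hno]|[a [b [V0 [k1 k2 e1 k3 hmin]]]]].
  left; split; first by rewrite g4.
  move=> c; rewrite ltnS leq_eqVlt => /orP[/eqP -> hacc|]; last exact: hno.
  by have := g3.2 (conj hacc _); rewrite e1 => /(_ isT).
right; exists a, b, V0; split=> //; first by rewrite g4.
  by move=> k hk; rewrite g5 // k3.
move=> c W; rewrite ltnS leq_eqVlt => /orP[/eqP -> hacc hW|]; last exact: hmin.
apply: leq_trans (score_uniq g2 hW); rewrite leqNgt; apply/negP => hlt.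
by have := g3.2 (conj hacc _); rewrite e1 /= ltnS hlt => /(_ isT).
Qed.

(** * Output of the best solution *)

Lemma report_ok env st (E' : seq tedge) : base st -> size E' = M ->
  (forall k, k < M -> nth (0, 0, 0) E' k = (tail k, head k, st 14 k)) ->
  let o := sem N env report st 0 in
  0 < o 0 < N /\ outval o = if st 15 1 == 0 then [:: 0] else 1 :: enc_edges E'.
Proof.
move=> [hr _ _ _ _] hsz hE; rewrite /report sem_cons.
set c1 := CFor 0 _.
have [h1 [h2 h3]] : let st' := sem N env c1 st in
    (forall k, k < M -> st' 0 (4 + (k + (k + k))) = st 14 k) /\
    (forall j, (forall k, j != 4 + (k + (k + k))) -> st' 0 j = st 0 j) /\
    (forall b j, b != 0 -> st' b j = st b j).
  rewrite /c1 sem_for; set F := fun i => _.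
  suff H i : let st' := iteri i F st in
    (forall k, k < i -> st' 0 (4 + (k + (k + k))) = st 14 k) /\
    (forall j, (forall k, j != 4 + (k + (k + k))) -> st' 0 j = st 0 j) /\
    (forall b j, b != 0 -> st' b j = st b j).
    by have [g1 [g2 g3]] := H N; split=> // k hk; apply: g1; lia.
  elim: i => [|i [g1 [g2 g3]]]; first by split.
  rewrite iteriS; move: (iteri i F st) g1 g2 g3 => st' g1 g2 g3; rewrite /F {F}.
  have [e1 e2] := @sem_set N (upd env 0 i) 0
    (EAdd (EC 4) (EAdd (EV 0) (EAdd (EV 0) (EV 0)))) (ER 14 (EV 0)) st'
    (4 + (i + (i + i))) (st 14 i) (erefl _) (g3 14 i isT).
  split=> [k|].
    rewrite ltnS leq_eqVlt => /orP[/eqP -> //|hk]; rewrite e2 ?g1 //; lia.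
  split=> [j hj|b j hb]; first by rewrite e2 ?g2 //; exact: hj.
  by rewrite e2 ?g3 ?hb.
move: (sem N env c1 st) h1 h2 h3 => st1 h1 h2 h3.
have eM1 : st1 0 1 = M by rewrite h2 ?hr ?nth_inp1 //; lia.
set e0 := EIf _ _ _.
have v0 : eval N env st1 e0 = if st 15 1 == 0 then 1 else 1 + (M + (M + M)).
  by rewrite /e0 /= h3 // eM1.
have [b2 f2] := @sem_set N env 0 (EC 0) e0 st1 0 _ (erefl _) v0.
rewrite sem_cons; move: (sem N env _ st1) b2 f2 => st2 b2 f2 {v0}.
rewrite [cSeq _]/=; set e1 := EIf _ _ _.
have v1 : eval N env st2 e1 = if st 15 1 == 0 then 0 else 1.
  by rewrite /e1 /= f2 // h3.
have [b3 f3] := @sem_set N env 0 (EC 1) e1 st2 1 _ (erefl _) v1.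
move: (sem N env _ st2) b3 f3 => st3 b3 f3.
have o0 : st3 0 0 = if st 15 1 == 0 then 1 else 1 + (M + (M + M)) by rewrite f3.
split; first by rewrite o0; case: (st 15 1 == 0); lia.
rewrite /outval b3 o0; case: (st 15 1 == 0) => //=; congr (_ :: _).
apply: (@eq_from_nth _ 0); first by rewrite size_mkseq size_enc_edges hsz.
rewrite size_mkseq => i hi; rewrite nth_mkseq // f3 // f2 //.
have hk : i %/ 3 < M by lia.
set k := i %/ 3 in hk *.
have hk' : k < size E' by rewrite hsz.
have [n0 n1 n2] := nth_enc_edges hk'; have [m0 m1 m2] := nth_enc_edges hk.
rewrite hE // in n0 n1 n2.
(* The remainder modulo 3 tells the field within the triple; the first two fields are still those of
   the input. *)
have : [\/ i = k + (k + k), i = (k + (k + k)).+1 | i = (k + (k + k)).+2].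
  have := divn_eq i 3; have := ltn_pmod i (isT : 0 < 3); rewrite -/k.
  case: (i %% 3) => [|[|[|]]] // _ e; [apply: Or31|apply: Or32|apply: Or33]; lia.
case=> e; rewrite {}e in hi *.
- rewrite h2; last by move=> j; lia.
  rewrite n0 hr; last by lia.
  by rewrite nth_inp_edge // m0 /= /tail hk.
- rewrite h2; last by move=> j; lia.
  rewrite n1 hr; last by lia.
  by rewrite nth_inp_edge // m1 /= /head hk.
- by rewrite n2 -h1.
Qed.

Lemma solver_ok env st : raw st -> let o := sem N env solver st 0 in
  0 < o 0 < N /\ correct_answer n E S (outval o).
Proof.
move=> hr; rewrite /solver (sem_seq _ _ setup) (sem_seq _ _ (CFor 0 candidate)).
have [hb h0] := setup_ok env hr; have {h0} [hb1 hbest] := candidates_ok env hb h0.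
move: (sem N env (CFor 0 candidate) _) hb1 hbest => st1 hb1 hbest {hb}.
have hnN : n <= N by lia.
have hlow := labels_spec.
have sound a b V := @accepted_sound n E wfE treeE S N t1 t2 sizeS hnN hlow a b V.
have center := @solution_center n E wfE treeE S N t1 t2 hnN hlow.
case: hbest => [[e1 hno]|[a [b [V [hacc hV e1 hout hmin]]]]].
  (* Without an accepted candidate the answer is [[:: 0]]; this list merely describes the store left
     behind. *)
  have [||h1 h2] := @report_ok env st1 [seq (tail k, head k, st1 14 k) | k <- iota 0 M] hb1.
  - by rewrite size_map size_iota.
  - by move=> k hk; rewrite (nth_map 0) ?size_iota // nth_iota.
  split=> //; rewrite h2 e1 /=; split=> [[F hF]|//].
  have [a [b [ha hab hacc _]]] := center F hF.
  have [c [hc ea eb]] := cand_index ha hab.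
  by case: (hno c hc); rewrite ea eb.
have [||h1 h2] := @report_ok env st1 (delayed n E S N t1 t2 a b) hb1.
- by rewrite size_map.
- move=> k hk; rewrite (nth_map (0, 0, 0)) // hout; last by lia.
  by rewrite /tail /head /label hk.
have [hsol hval] := sound a b V hacc hV.
split=> //; rewrite h2 e1 /=; split=> [_|hno]; last first.
  by case: hno; exists (delayed n E S N t1 t2 a b).
exists (delayed n E S N t1 t2 a b); split=> //; split=> // F hF.
(* The center of [F] is among the accepted candidates, so its score is at least [V] and at most the
   value of [F]. *)
have [a' [b' [ha hab hacc' hle]]] := center F hF.
have [c [hc ea eb]] := cand_index ha hab.
have [W hW] := score_ex a' b'.
have hVW : V <= W by rewrite -ea -eb in hacc' hW; exact: hmin hc hacc' hW.
have := hle W hW; move: hval; case: (value n S (delayed _ _ _ _ _ _ _ _)) => [x|] //=.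
case: (value n S F) => [y|] //= hxV hWy.
exact: leq_trans hxV (leq_trans hVW hWy).
Qed.

End Instance.


Theorem theorem4 :
  exists (p : program) (c d : nat),
    forall (n : nat) (E : seq tedge) (S : seq nat),
      valid_tree_instance n E S ->
      let inp := enc_instance n E S in
      let s := exec p (c * insize inp ^ d + c) (init inp) in
      halted p s /\ correct_answer n E S (output s).
Proof.
have [c [d h]] := compile_ok solver_wf.
exists (compile solver), c, d => n E S [wfE [treeE sizeS]] inp.
(* The number of vertices and the lengths of both lists are always present. *)
have hsz : 3 <= size inp by rewrite (size_inp wfE sizeS); lia.
have [st hst hok] := h inp hsz.
have [ho hans] := solver_ok wfE treeE sizeS (fun=> 0) hst.
by have [h1 h2] := hok ho; split; rewrite ?h2.
Qed.
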